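(* Let $p>2$ be a prime, $\mathbf{F}$ a field of characteristic $p$, $M=(c_{ij})\in\mathbf{F}^{2\times2}$, and let $V_M$ be the associated three-dimensional representation of $G=(\mathbf{Z}/p)^2=\langle e_1,e_2\rangle$, so that $G$ acts on $\mathbf{F}[V_M]=\mathbf{F}[x,y,z]$ by algebra automorphisms with $x\cdot e_i=x$, $y\cdot e_i=y+c_{1i}x$, $z\cdot e_i=z+2c_{1i}y+(c_{1i}^2+c_{2i})x$ for $i=1,2$. Let $\overline\gamma_{ij}$, $h$, $N_G(y)$, $N_G(z)$ be as defined in the context. If $\overline\gamma_{12}\neq0$ and $\overline\gamma_{13}=0$, then $\{x,N_G(y),h,N_G(z)\}$ is a SAGBI basis for $\mathbf{F}[V_M]^G$ with respect to the graded reverse lexicographic order with $x<y<z$. Furthermore, there is a single relation among the generators, constructed by subducting $\overline\gamma_{23}^{\,p}N_G(y)^{p+1}-h^p$.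
   Context: Let $\delta=y^2-xz$. Let $\overline\gamma_{ij}\in\mathbf{F}$ be the $2\times 2$ minor, on rows $i<j$, of the matrix with rows $(c_{11},c_{12})$, $(c_{21},c_{22})$, $(c_{11}^p,c_{12}^p)$, $(c_{21}^p,c_{22}^p)$ (rows $1$ to $4$). When $\overline\gamma_{12}\ne0$ and $\overline\gamma_{13}=0$, define the invariant $$h=\overline\gamma_{23}y^{p+1}+\tfrac12\left(\overline\gamma_{12}xz^p+x^{p-1}\left(\overline\gamma_{14}\delta+\frac{\overline\gamma_{23}^{\,2}y^2}{\overline\gamma_{12}}\right)+\overline\gamma_{24}yx^p\right).$$ For $f\in\mathbf{F}[x,y,z]$, $N_G(f)$ is the product of the (distinct) elements of the $G$-orbit of $f$. A subset $\mathcal{B}$ of a subalgebra $A$ of a polynomial ring is a SAGBI basis for $A$ if the lead monomials of the elements of $\mathcal{B}$ generate, as an algebra, the lead term algebra of $A$ (the algebra spanned by the lead monomials of nonzero elements of $A$); then $\mathcal{B}$ generates $A$. To subduct a polynomial $F$ over $\mathcal{B}$ is to repeatedly subtract from it scalar multiples of products of elements of $\mathcal{B}$ having the same lead term as the current polynomial; for a SAGBI basis, every $F\in A$ subducts to $0$. If $F$ is a polynomial expression in elements of $\mathcal{B}$, its subduction to $0$ yields an identity $F-\sum_I c_I\,b^I=0$ with products $b^I$ of elements of $\mathcal{B}$: this is the relation constructed by subducting $F$. ''A single relation'' means that the ideal of all algebraic relations among the listed generators is generated by that one relation. *)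

(* Defs.v *)
From HB Require Import structures.
From mathcomp Require Import all_boot all_order all_algebra all_fingroup.
From mathcomp Require Import ring.
From mathcomp Require Export mpoly.

Set Implicit Arguments.
Unset Strict Implicit.
Unset Printing Implicit Defensive.

Import GRing.Theory.

Local Open Scope ring_scope.

(* Graded reverse lexicographic order with 'X_0 < 'X_1 < ... < 'X_(n-1).
   The order that mpoly.v puts on 'X_{1..n}, hence mlead, is not usable here:
   it compares the degrees and then the exponents lexicographically from index
   0 on, although the header of that file calls it degrevlex. *)
Definition grevlex_lt n (m1 m2 : 'X_{1..n}) : bool :=
  (mdeg m1 < mdeg m2)%N ||
  (mdeg m1 == mdeg m2) &&
  [exists i : 'I_n, (m2 i < m1 i)%N &&
     [forall j : 'I_n, (j < i)%N ==> (m1 j == m2 j)]].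

Definition grevlex_max n (m1 m2 : 'X_{1..n}) : 'X_{1..n} :=
  if grevlex_lt m1 m2 then m2 else m1.

Lemma grevlex_lt_trans n : transitive (@grevlex_lt n).
Proof.
move=> b a c /orP[ab|/andP[/eqP ab /existsP[i /andP[i1 /forallP i2]]]]
  /orP[bc|/andP[/eqP bc /existsP[j /andP[j1 /forallP j2]]]]; apply/orP.
- by left; apply: ltn_trans bc.
- by left; rewrite -bc.
- by left; rewrite ab.
right; rewrite ab bc eqxx /=; apply/existsP.
have [ij|ji|ij] := ltngtP i j.
- exists i; rewrite -(eqP (implyP (j2 i) ij)) i1 /=; apply/forallP=> k; apply/implyP=> ki.
  by rewrite (eqP (implyP (i2 k) ki)) (implyP (j2 k)) // (ltn_trans ki).
- exists j; rewrite (eqP (implyP (i2 j) ji)) j1 /=; apply/forallP=> k; apply/implyP=> kj.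
  by rewrite (eqP (implyP (i2 k) (ltn_trans kj ji))) (implyP (j2 k)).
exists j; move: i1; rewrite (val_inj ij) => i1; rewrite (ltn_trans j1 i1) /=.
apply/forallP=> k; apply/implyP=> kj.
by rewrite (eqP (implyP (i2 k) _)) ?(implyP (j2 k)) ?ij.
Qed.

Lemma grevlex_lt_irr n : irreflexive (@grevlex_lt n).
Proof.
move=> m; rewrite /grevlex_lt ltnn eqxx /=; apply/negbTE/negP.
by move=> /existsP[i]; rewrite ltnn.
Qed.

Lemma grevlex_lt_total n (a b : 'X_{1..n}) : a != b -> grevlex_lt a b || grevlex_lt b a.
Proof.
move=> ab; rewrite /grevlex_lt; case: ltngtP => //= _.
have [i0 hi0] : exists i, a i != b i.
  apply/existsP; apply: contraNT ab; rewrite negb_exists => /forallP h.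
  by apply/eqP/mnmP => i; move: (h i); rewrite negbK => /eqP.
case: (@arg_minnP _ i0 (fun i => a i != b i) (fun i : 'I_n => val i) hi0) => i hi mi.
have lt (j : 'I_n) : (j < i)%N -> a j == b j.
  by move=> ji; apply: contraTT ji => /mi; rewrite -leqNgt.
have [h|h|h] := ltngtP (a i) (b i); last by rewrite h eqxx in hi.
  apply/orP; right; apply/existsP; exists i; rewrite h /=.
  by apply/forallP => j; apply/implyP => /lt; rewrite eq_sym.
by apply/orP; left; apply/existsP; exists i; rewrite h /=;
  apply/forallP => j; apply/implyP => /lt.
Qed.

Section LeadTerms.

Variables (F : fieldType) (n : nat).
Implicit Types (f g : {mpoly F[n]}) (A B : {pred {mpoly F[n]}}).

(* Equal to 0%MM when f = 0. *)
Definition lead_mon f : 'X_{1..n} :=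
  \big[@grevlex_max n/0%MM]_(m <- msupp f) m.

Lemma lead_monP f : f != 0 ->
  lead_mon f \in msupp f /\ {in msupp f, forall m, ~~ grevlex_lt (lead_mon f) m}.
Proof.
move=> f0; rewrite /lead_mon.
have ge0 m : ~~ grevlex_lt m (0%MM : 'X_{1..n}).
  rewrite /grevlex_lt mdeg0 ltn0 /= negb_and.
  apply/orP; case: eqP => [h|_]; [right|by left].
  by apply/existsPn => i; rewrite (eqP (_ : m == 0%MM)) ?mnm0E // -mdeg_eq0 h.
have H : forall s : seq 'X_{1..n}, s != [::] ->
  (\big[@grevlex_max n/0%MM]_(m <- s) m) \in s /\
  {in s, forall m, ~~ grevlex_lt (\big[@grevlex_max n/0%MM]_(m <- s) m) m}.
  elim=> [//|a s IH] _; rewrite big_cons.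
  have [->|/IH[]] := eqVneq s [::].
    rewrite big_nil /grevlex_max (negbTE (ge0 a)) inE eqxx; split=> // m.
    by rewrite inE => /eqP->; rewrite grevlex_lt_irr.
  set M := \big[_/_]_(_ <- _) _ => Ms Mm; rewrite /grevlex_max; case: ifP => h.
    split; first by rewrite inE Ms orbT.
    move=> m; rewrite inE => /orP[/eqP->|/Mm//].
    by apply/negP => /(grevlex_lt_trans h); rewrite grevlex_lt_irr.
  split; first by rewrite inE eqxx.
  move=> m; rewrite inE => /orP[/eqP->|ms]; first by rewrite grevlex_lt_irr.
  apply/negP => am; have [e|ne] := eqVneq a M; first by move: (Mm _ ms); rewrite -e am.
  move: (grevlex_lt_total ne); rewrite h /= => Ma.
  by move: (Mm _ ms); rewrite (grevlex_lt_trans Ma am).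
by apply: H; rewrite msupp_eq0.
Qed.

Definition lead_term f : {mpoly F[n]} := f@_(lead_mon f) *: 'X_[lead_mon f].

Definition lead_mons A : {mpoly F[n]} -> Prop :=
  fun u => exists f, [/\ f \in A, f != 0 & u = 'X_[lead_mon f]].

Inductive lin_span (S : {mpoly F[n]} -> Prop) : {mpoly F[n]} -> Prop :=
| lin_span0 : lin_span S 0
| lin_spanD a f g : S f -> lin_span S g -> lin_span S (a *: f + g).

Inductive alg_span (S : {mpoly F[n]} -> Prop) : {mpoly F[n]} -> Prop :=
| alg_span_gen f : S f -> alg_span S f
| alg_spanC a : alg_span S a%:MP
| alg_spanD f g : alg_span S f -> alg_span S g -> alg_span S (f + g)
| alg_spanM f g : alg_span S f -> alg_span S g -> alg_span S (f * g).

Definition lead_term_algebra A : {mpoly F[n]} -> Prop := lin_span (lead_mons A).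

Definition sagbi_basis A B : Prop :=
  [/\ subalg_closed A, {subset B <= A} &
      forall f, alg_span (lead_mons B) f <-> lead_term_algebra A f].

Variables (k : nat) (b : k.-tuple {mpoly F[n]}).

(* The product b^I, with I : 'X_{1..k}. *)
Definition bprod (I : 'X_{1..k}) : {mpoly F[n]} :=
  \prod_(i < k) tnth b i ^+ I i.

(* [subducts0 f S]: some subduction of f over b ends at 0, and
   S = \sum_I c_I *: 'X_[I] records the multiples c_I *: b^I that it subtracts,
   so that f = S \mPo b. *)
Inductive subducts0 : {mpoly F[n]} -> {mpoly F[k]} -> Prop :=
| subducts0_nil : subducts0 0 0
| subducts0_step f c I S :
    f != 0 -> lead_term (c *: bprod I) = lead_term f ->
    subducts0 (f - c *: bprod I) S -> subducts0 f (c *: 'X_[I] + S).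

Definition relation_ideal_generated_by (R : {mpoly F[k]}) : Prop :=
  forall P : {mpoly F[k]}, P \mPo b = 0 <-> exists Q, P = Q * R.

(* The relation obtained by subducting T(b), for a polynomial expression T in
   the elements of b, is T - S where S records a subduction of T(b) to 0; the
   choices made in the subduction are irrelevant. *)
Definition single_relation_by_subducting (T : {mpoly F[k]}) : Prop :=
  (exists S, subducts0 (T \mPo b) S) /\
  (forall S, subducts0 (T \mPo b) S -> relation_ideal_generated_by (T - S)).

End LeadTerms.

Section Representation.

(* The entry c_ij of M is M (i - 1) (j - 1). *)
Variables (p : nat) (F : fieldType) (M : 'M[F]_2).

Definition vx : {mpoly F[3]} := 'X_0.
Definition vy : {mpoly F[3]} := 'X_1.
Definition vz : {mpoly F[3]} := 'X_(2%:R).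

(* The algebra endomorphism f |-> f . e_(i+1). *)
Definition gen_act (i : 'I_2) (f : {mpoly F[3]}) : {mpoly F[3]} :=
  f \mPo [tuple vx;
                vy + M 0 i *: vx;
                vz + (M 0 i *+ 2) *: vy + (M 0 i ^+ 2 + M 1 i) *: vx].

(* The additive group (Z/p)^2, with e_1 = (1, 0) and e_2 = (0, 1). *)
Definition elem_ab : finGroupType := ('Z_p * 'Z_p)%type.

(* f . (e_1^a e_2^b) *)
Definition VM_act (f : {mpoly F[3]}) (g : elem_ab) : {mpoly F[3]} :=
  iter (val g.2) (gen_act 1) (iter (val g.1) (gen_act 0) f).

(* The action of e_1^a e_2^b has this form, by VM_actE. *)
Definition unip (c d : F) (f : {mpoly F[3]}) : {mpoly F[3]} :=
  f \mPo [tuple vx; vy + c *: vx; vz + (c *+ 2) *: vy + (c ^+ 2 + d) *: vx].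

Lemma unip_comp c d c' d' f :
  unip c' d' (unip c d f) = unip (c + c') (d + d') f.
Proof.
rewrite /unip !(comp_mpolyEX f) raddf_sum /=.
apply: eq_bigr => m _; rewrite comp_mpolyZ !comp_mpolyX rmorph_prod /=; congr (_ *: _).
apply: eq_bigr => i _; rewrite rmorphXn /=; congr (_ ^+ _).
case: i => [[|[|[|//]]]] ?; rewrite !(tnth_nth 0) /=;
  rewrite !(comp_mpolyD, comp_mpolyZ, comp_mpolyXU) //= -!mul_mpolyC.
  by rewrite mpolyCD; ring.
by rewrite !(mpolyCD, mpolyCMn, expr2, mpolyCM); ring.
Qed.

Lemma unip0 f : unip 0 0 f = f.
Proof.
rewrite -[RHS]comp_mpoly_id; congr (_ \mPo _); apply: eq_from_tnth => i.
rewrite tnth_mktuple (tnth_nth 0); case: i => [[|[|[|//]]]] i /=;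
  rewrite ?expr0n ?mul0rn ?addr0 ?scale0r ?addr0; congr ('X_ _); exact: val_inj.
Qed.

Lemma iter_gen_act n i f :
  iter n (gen_act i) f = unip (M 0 i *+ n) (M 1 i *+ n) f.
Proof.
elim: n f => [|n IH] f; first by rewrite !mulr0n unip0.
by rewrite iterS IH -[gen_act _ _]/(unip _ _ _) unip_comp !mulrSr.
Qed.

Lemma VM_actE f (g : elem_ab) :
  VM_act f g = unip (M 0 0 *+ val g.1 + M 0 1 *+ val g.2)
                   (M 1 0 *+ val g.1 + M 1 1 *+ val g.2) f.
Proof. by rewrite /VM_act !iter_gen_act unip_comp. Qed.

Lemma mulrn_Zp (charF : p \in [pchar F]) (c : F) (a b : 'Z_p) :
  c *+ val (a + b) = c *+ val a + c *+ val b.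
Proof.
have p1 : (1 < p)%N by rewrite prime_gt1 ?(pcharf_prime charF).
rewrite -mulrnDr -[LHS]mulr_natr -[RHS]mulr_natr; congr (_ * _).
have -> : val (a + b) = ((val a + val b) %% p)%N.
  by rewrite /= [X in (_ %% X)%N = _]Zp_cast.
rewrite [in RHS](divn_eq (val a + val b) p) natrD natrM.
by rewrite (pcharf0 charF) mulr0 add0r.
Qed.

Lemma VM_act1 f : VM_act f (1%g : elem_ab) = f.
Proof. by []. Qed.

Lemma VM_actM (charF : p \in [pchar F]) f (g h : elem_ab) :
  VM_act f (g * h)%g = VM_act (VM_act f g) h.
Proof.
case: g h => [g1 g2] [h1 h2]; rewrite (VM_actE f (_, _)) (VM_actE _ (h1, h2)).
transitivity (unip (M 0 0 *+ val (g1 + h1) + M 0 1 *+ val (g2 + h2))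
                   (M 1 0 *+ val (g1 + h1) + M 1 1 *+ val (g2 + h2)) f).
  exact: (VM_actE f (g1 + h1, g2 + h2)).
by rewrite unip_comp !(mulrn_Zp charF) !(addrACA _ (_ *+ val h1)).
Qed.

Lemma VM_act_action (charF : p \in [pchar F]) : is_action [set: elem_ab] VM_act.
Proof.
split=> [a f g efg | f a b _ _]; last exact: (VM_actM charF).
rewrite -(VM_act1 f) -(VM_act1 g) -(mulgV a).
by rewrite (VM_actM charF f) (VM_actM charF g) efg.
Qed.

Definition VM_invariants : {pred {mpoly F[3]}} :=
  [pred f | [forall g : elem_ab, VM_act f g == f]].

Lemma VM_invariants_subalg : subalg_closed VM_invariants.
Proof.
split.
- by apply/forallP => g; rewrite VM_actE /unip rmorph1.
- move=> a f g /forallP hf /forallP hg; apply/forallP => k; move: (hf k) (hg k).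
  by rewrite !VM_actE /unip linearP /= => /eqP-> /eqP->.
- move=> f g /forallP hf /forallP hg; apply/forallP => k; move: (hf k) (hg k).
  by rewrite !VM_actE /unip rmorphM /= => /eqP-> /eqP->.
Qed.

Definition orbit_product (f : {mpoly F[3]}) : {mpoly F[3]} :=
  \prod_(u <- undup [seq VM_act f g | g : elem_ab]) u.

Definition gamma_mx : 'M[F]_(2 + 2, 2) :=
  col_mx M (map_mx (fun c => c ^+ p) M).

(* Rows are numbered from 0. *)
Definition minor2 (i j : 'I_(2 + 2)) : F :=
  \det (rowsub (tnth [tuple i; j]) gamma_mx).

Definition gamma12 := minor2 0 1.
Definition gamma13 := minor2 0 2%:R.
Definition gamma14 := minor2 0 3%:R.
Definition gamma23 := minor2 1 2%:R.
Definition gamma24 := minor2 1 3%:R.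

Definition delta : {mpoly F[3]} := vy ^+ 2 - vx * vz.

Definition hinv : {mpoly F[3]} :=
  gamma23 *: vy ^+ p.+1 +
  2%:R^-1 *: (gamma12 *: (vx * vz ^+ p)
              + vx ^+ p.-1 * (gamma14 *: delta
                              + (gamma23 ^+ 2 / gamma12) *: vy ^+ 2)
              + gamma24 *: (vy * vx ^+ p)).

Definition VM_gens : 4.-tuple {mpoly F[3]} :=
  [tuple vx; orbit_product vy; hinv; orbit_product vz].

End Representation.

(* Main.v *)
From HB Require Import structures.
Require Import Defs.
From mathcomp Require Import all_boot all_order all_algebra all_fingroup.
From mathcomp Require Import ring zify.

(* Write C and D for the entries of M (a, b)^T.  Since gamma13 = 0, the p-th
   power map multiplies every C by the same lambda <> 0, so C takes exactly p
   values, and some group element acts as z |-> z + d x with d <> 0.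

   Comparing coefficients in F[x][y][z], an invariant has degree divisible by p
   in z, and its top coefficient is a polynomial in x and N(y).  As h has top
   term (gamma12/2) x z^p, subtracting powers of h shows that every invariant
   becomes a polynomial in x, N(y) and h after multiplication by a power of x.

   The lead monomials of the products x^i N(y)^j h^k N(z)^l with k < p are
   pairwise distinct.  Hence the span of these products is stable under
   division by x.  Localizing x^p N(z) - (2 h / gamma12)^p, whose degree in z is
   less than p^2, shows that h^p lies in this span, which is therefore the
   whole ring of invariants.  For the relation, if S records a subduction of
   T(b), then S - T is monic of degree p in the variable of h: every product
   recorded in S has lead monomial below y^(p(p+1)), which bounds its degree. *)

Set Implicit Arguments.
Unset Strict Implicit.
Unset Printing Implicit Defensive.

Import GRing.Theory.
Local Open Scope ring_scope.

(** * Lead monomials for the graded reverse lexicographic order *)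

Section Grevlex.

Variables (n : nat) (F : fieldType).
Implicit Types (m : 'X_{1..n}) (f g : {mpoly F[n]}) (c : F).

Lemma grevlex_lt_add2r m m1 m2 :
  grevlex_lt (m1 + m)%MM (m2 + m)%MM = grevlex_lt m1 m2.
Proof.
rewrite /grevlex_lt !mdegD ltn_add2r eqn_add2r; congr (_ || _ && _).
apply: eq_existsb => i; rewrite !mnmDE ltn_add2r; congr (_ && _).
by apply: eq_forallb => j; rewrite !mnmDE eqn_add2r.
Qed.

Definition grevlex_le m1 m2 := (m1 == m2) || grevlex_lt m1 m2.

Lemma grevlex_le_refl m : grevlex_le m m.
Proof. by rewrite /grevlex_le eqxx. Qed.

Lemma grevlex_le_lt_trans m2 m1 m3 :
  grevlex_le m1 m2 -> grevlex_lt m2 m3 -> grevlex_lt m1 m3.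
Proof. by case/orP=> [/eqP->//|]; apply: grevlex_lt_trans. Qed.

Lemma grevlex_lt_le_trans m2 m1 m3 :
  grevlex_lt m1 m2 -> grevlex_le m2 m3 -> grevlex_lt m1 m3.
Proof. by move=> lt12 /orP[/eqP<-//|]; apply: grevlex_lt_trans. Qed.

Lemma grevlex_le_trans m2 m1 m3 :
  grevlex_le m1 m2 -> grevlex_le m2 m3 -> grevlex_le m1 m3.
Proof.
by case/orP=> [/eqP->//|lt12 le23]; rewrite /grevlex_le (grevlex_lt_le_trans lt12 le23) orbT.
Qed.

Lemma grevlex_ltNge m1 m2 : ~~ grevlex_le m2 m1 -> grevlex_lt m1 m2.
Proof.
by rewrite negb_or => /andP[/grevlex_lt_total/orP[->|]].
Qed.

Lemma grevlex_le_add m1 m2 m3 m4 :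
  grevlex_le m1 m2 -> grevlex_le m3 m4 -> grevlex_le (m1 + m3)%MM (m2 + m4)%MM.
Proof.
move=> le12 le34; apply: (@grevlex_le_trans (m2 + m3)%MM).
  case/orP: le12 => [/eqP->|lt12]; first exact: grevlex_le_refl.
  by rewrite /grevlex_le grevlex_lt_add2r lt12 orbT.
case/orP: le34 => [/eqP->|lt34]; first exact: grevlex_le_refl.
by rewrite /grevlex_le ![(m2 + _)%MM]addmC grevlex_lt_add2r lt34 orbT.
Qed.

Lemma grevlex_le_mdeg m1 m2 : grevlex_le m1 m2 -> (mdeg m1 <= mdeg m2)%N.
Proof. by case/orP=> [/eqP->//|/orP[/ltnW//|/andP[/eqP->]]]. Qed.

Lemma grevlex_maxP (T : eqType) (e : T -> 'X_{1..n}) (s : seq T) : s != [::] ->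
  exists2 t, t \in s & {in s, forall u, grevlex_le (e u) (e t)}.
Proof.
elim: s => [//|t s IHs] _; have [->|/IHs[u us umax]] := eqVneq s [::].
  exists t => [|u]; rewrite inE ?eqxx // => /eqP->.
  exact: grevlex_le_refl.
case: (boolP (grevlex_le (e t) (e u))) => [le_tu|/grevlex_ltNge lt_ut].
  exists u => [|v]; rewrite inE ?us ?orbT // => /orP[/eqP->//|]; exact: umax.
exists t => [|v]; rewrite inE ?eqxx // => /orP[/eqP->|/umax vu].
  exact: grevlex_le_refl.
by rewrite /grevlex_le (grevlex_le_lt_trans vu lt_ut) orbT.
Qed.

Definition supp_lt f m := {in msupp f, forall m', grevlex_lt m' m}.

(** The coefficient [c] may be 0, which leaves only an upper bound on the support. Products
    therefore need no side condition, and [c != 0] is asked for only when passing back to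
    [lead_mon]. *)
Definition has_lead f m c := supp_lt (f - c *: 'X_[m]) m.

Lemma supp_lt0 m : supp_lt 0 m.
Proof. by move=> m'; rewrite msupp0. Qed.

Lemma supp_ltD f g m : supp_lt f m -> supp_lt g m -> supp_lt (f + g) m.
Proof. by move=> ltf ltg m' /msuppD_le; rewrite mem_cat => /orP[/ltf|/ltg]. Qed.

Lemma supp_ltZ c f m : supp_lt f m -> supp_lt (c *: f) m.
Proof. by move=> ltf m' /msuppZ_le/ltf. Qed.

Lemma supp_ltB f g m : supp_lt f m -> supp_lt g m -> supp_lt (f - g) m.
Proof. by move=> ltf ltg; rewrite -scaleN1r; apply/supp_ltD/supp_ltZ. Qed.

Lemma supp_ltX m m' : grevlex_lt m' m -> supp_lt 'X_[m'] m.
Proof. by move=> lt m1; rewrite msuppX inE => /eqP->. Qed.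

Lemma supp_lt_sum (I : eqType) (r : seq I) (G : I -> {mpoly F[n]}) m :
  {in r, forall i, supp_lt (G i) m} -> supp_lt (\sum_(i <- r) G i) m.
Proof.
move=> ltG; rewrite big_seq; elim/big_rec: _ => [|i f ri ltf]; first exact: supp_lt0.
exact/supp_ltD/ltf/ltG.
Qed.

Lemma supp_lt_coef f m : supp_lt f m -> f@_m = 0.
Proof.
move=> ltf; apply/eqP; rewrite mcoeff_eq0; apply/negP => /ltf.
by rewrite grevlex_lt_irr.
Qed.

Lemma supp_ltM f g m1 m2 : supp_lt f m1 ->
  {in msupp g, forall m, grevlex_le m m2} -> supp_lt (f * g) (m1 + m2)%MM.
Proof.
move=> ltf leg m /msuppM_le/allpairsP[[a b] [/= /ltf lta /leg leb ->]].
apply: (@grevlex_lt_le_trans (m1 + b)%MM); first by rewrite grevlex_lt_add2r.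
exact/grevlex_le_add/leb/grevlex_le_refl.
Qed.

Lemma has_lead_supp f m c :
  has_lead f m c -> {in msupp f, forall m', grevlex_le m' m}.
Proof.
move=> ltf m'; rewrite -[f](subrK (c *: 'X_[m])) => /msuppD_le.
rewrite mem_cat => /orP[/ltf lt|/msuppZ_le].
  by rewrite /grevlex_le lt orbT.
by rewrite msuppX inE => /eqP->; apply: grevlex_le_refl.
Qed.

Lemma has_lead_coef f m c : has_lead f m c -> f@_m = c.
Proof.
move/supp_lt_coef/eqP; rewrite mcoeffB mcoeffZ mcoeffX eqxx mulr1 subr_eq0.
by move/eqP.
Qed.

Lemma has_lead_lt f m c m' : has_lead f m c -> grevlex_lt m m' -> supp_lt f m'.
Proof. by move=> /has_lead_supp lef lt m1 /lef le; apply: grevlex_le_lt_trans lt. Qed.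

Lemma has_leadP f m c :
  f@_m = c -> {in msupp f, forall m', grevlex_le m' m} -> has_lead f m c.
Proof.
move=> fm fle m' m'f; suff ne : m' != m.
  move: m'f => /msuppB_le; rewrite mem_cat => /orP[/fle|/msuppZ_le].
    by rewrite /grevlex_le (negbTE ne).
  by rewrite msuppX inE (negbTE ne).
apply: contraTneq m'f => ->.
by rewrite mcoeff_msupp mcoeffB mcoeffZ mcoeffX eqxx mulr1 fm subrr eqxx.
Qed.

Lemma has_lead_neq0 f m c : has_lead f m c -> c != 0 -> f != 0.
Proof. by move/has_lead_coef => <-; apply: contraNneq => ->; rewrite mcoeff0. Qed.

Lemma lead_mon_has_lead f : f != 0 -> has_lead f (lead_mon f) f@_(lead_mon f).
Proof.
move=> f0; apply: has_leadP => // m' m'f; have [_ /(_ _ m'f) h] := lead_monP f0.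
by apply: contraNT h => /grevlex_ltNge.
Qed.

Lemma lead_coef_neq0 f : f != 0 -> f@_(lead_mon f) != 0.
Proof. by move=> f0; rewrite -mcoeff_msupp; case: (lead_monP f0). Qed.

Lemma has_lead_lead_mon f m c : has_lead f m c -> c != 0 -> lead_mon f = m.
Proof.
move=> lf c0; have mf : m \in msupp f by rewrite mcoeff_msupp (has_lead_coef lf).
have [/(has_lead_supp lf) /orP[/eqP//|lt_lead]] := lead_monP (has_lead_neq0 lf c0).
by move/(_ _ mf); rewrite lt_lead.
Qed.

Lemma has_leadX m : has_lead 'X_[m] m 1.
Proof. by rewrite /has_lead scale1r subrr; apply: supp_lt0. Qed.

Lemma has_leadDl f g m c : has_lead f m c -> supp_lt g m -> has_lead (f + g) m c.
Proof. by rewrite /has_lead => ltf ltg; rewrite addrAC; apply: supp_ltD. Qed.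

Lemma has_leadZ (a : F) f m c : has_lead f m c -> has_lead (a *: f) m (a * c).
Proof. by move=> ltf; rewrite /has_lead -scalerA -scalerBr; apply: supp_ltZ. Qed.

Lemma has_leadM f g m1 m2 c1 c2 : has_lead f m1 c1 -> has_lead g m2 c2 ->
  has_lead (f * g) (m1 + m2)%MM (c1 * c2).
Proof.
move=> lf lg; rewrite /has_lead.
have -> : f * g - (c1 * c2) *: 'X_[m1 + m2] =
    (f - c1 *: 'X_[m1]) * g + (g - c2 *: 'X_[m2]) * (c1 *: 'X_[m1]).
  by rewrite mpolyXD -!mul_mpolyC mpolyCM; ring.
apply: supp_ltD; first exact: supp_ltM (has_lead_supp lg).
rewrite addmC; apply: supp_ltM => // m /msuppZ_le; rewrite msuppX inE => /eqP->.
exact: grevlex_le_refl.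
Qed.

Lemma has_lead1 : has_lead 1 0%MM 1.
Proof. by rewrite -mpolyX0; apply: has_leadX. Qed.

Lemma has_lead_exp f m c k : has_lead f m c -> has_lead (f ^+ k) (m *+ k)%MM (c ^+ k).
Proof.
move=> lf; elim: k => [|k IHk]; first by rewrite mulm0n !expr0; apply: has_lead1.
by rewrite mulmS !exprS; apply: has_leadM.
Qed.

Lemma has_lead_prod (I : Type) (r : seq I) (G : I -> {mpoly F[n]})
    (e : I -> 'X_{1..n}) (c : I -> F) :
  (forall i, has_lead (G i) (e i) (c i)) ->
  has_lead (\prod_(i <- r) G i) (\sum_(i <- r) e i)%MM (\prod_(i <- r) c i).
Proof.
move=> lG; elim: r => [|i r IHr]; first by rewrite !big_nil; apply: has_lead1.
by rewrite !big_cons; apply: has_leadM.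
Qed.

Lemma lead_monM f g : f != 0 -> g != 0 ->
  lead_mon (f * g) = (lead_mon f + lead_mon g)%MM.
Proof.
move=> f0 g0; apply: has_lead_lead_mon (has_leadM (lead_mon_has_lead f0) (lead_mon_has_lead g0)) _.
by rewrite mulf_neq0 ?lead_coef_neq0.
Qed.

(** The exponents are distinct, so the largest one comes from a single summand and cannot cancel. *)
Lemma has_lead_sum_inj (I : eqType) (r : seq I) (G : I -> {mpoly F[n]})
    (e : I -> 'X_{1..n}) (c : I -> F) :
  uniq r -> r != [::] -> {in r &, injective e} ->
  {in r, forall i, has_lead (G i) (e i) (c i)} ->
  exists2 i, i \in r & has_lead (\sum_(i <- r) G i) (e i) (c i).
Proof.
move=> r_uniq r0 e_inj lG; have [i ir imax] := grevlex_maxP e r0.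
exists i => //; rewrite (bigD1_seq i) //=; apply/(has_leadDl (lG _ ir)).
rewrite -big_filter; apply: supp_lt_sum => j; rewrite mem_filter => /andP[ji jr].
apply: has_lead_lt (lG _ jr) _; have /orP[/eqP eij|//] := imax _ jr.
by rewrite (e_inj _ _ jr ir eij) eqxx in ji.
Qed.

End Grevlex.

(** * Normal forms *)

Section DegreeInOneVariable.

Variables (n : nat) (F : fieldType) (i : 'I_n).
Implicit Types (m : 'X_{1..n}) (P Q : {mpoly F[n]}) (k : nat).

Definition deg_lt k P := {in msupp P, forall m, (m i < k)%N}.

Lemma deg_ltW k l P : (k <= l)%N -> deg_lt k P -> deg_lt l P.
Proof. by move=> le_kl ltP m /ltP lt; apply: leq_trans le_kl. Qed.

Lemma deg_lt0 k : deg_lt k 0.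
Proof. by move=> m; rewrite msupp0. Qed.

Lemma deg_ltD k P Q : deg_lt k P -> deg_lt k Q -> deg_lt k (P + Q).
Proof. by move=> ltP ltQ m /msuppD_le; rewrite mem_cat => /orP[/ltP|/ltQ]. Qed.

Lemma deg_ltZ k c P : deg_lt k P -> deg_lt k (c *: P).
Proof. by move=> ltP m /msuppZ_le/ltP. Qed.

Lemma deg_ltN k P : deg_lt k P -> deg_lt k (- P).
Proof. by rewrite -scaleN1r; apply: deg_ltZ. Qed.

Lemma deg_ltB k P Q : deg_lt k P -> deg_lt k Q -> deg_lt k (P - Q).
Proof. by move=> ltP ltQ; apply/deg_ltD/deg_ltN. Qed.

Lemma deg_ltM k l P Q : deg_lt k.+1 P -> deg_lt l Q -> deg_lt (k + l) (P * Q).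
Proof.
move=> ltP ltQ m /msuppM_le/allpairsP[[a b] [/= /ltP lta /ltQ ltb ->]].
by rewrite mnmDE; lia.
Qed.

Lemma deg_ltX m : deg_lt (m i).+1 'X_[m].
Proof. by move=> m'; rewrite msuppX inE => /eqP->. Qed.

Lemma deg_lt_sum (I : eqType) (r : seq I) (G : I -> {mpoly F[n]}) k :
  {in r, forall j, deg_lt k (G j)} -> deg_lt k (\sum_(j <- r) G j).
Proof.
move=> ltG; rewrite big_seq; elim/big_rec: _ => [|j f rj ltf]; first exact: deg_lt0.
exact/deg_ltD/ltf/ltG.
Qed.

Lemma deg_lt_exists P : exists k, deg_lt k P.
Proof.
exists (\max_(m <- msupp P) m i).+1 => m mP.
by rewrite ltnS; apply: (@leq_bigmax_seq _ (msupp P) xpredT (fun m => m i)).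
Qed.

(* The hypothesis says that [D] is monic of degree [d] as a polynomial in ['X_i]. *)
Lemma deg_lt_division d D P : deg_lt d (D - 'X_i ^+ d) ->
  exists Q r, P = Q * D + r /\ deg_lt d r.
Proof.
move=> ltD; have [k] := deg_lt_exists P; elim: k P => [|k IHk] P ltP.
  (* No exponent is below 0, so the support of [P] is empty here. *)
  exists 0, 0; split; last exact: deg_lt0.
  rewrite mul0r addr0; apply: msuppnil0.
  by move: ltP; rewrite /deg_lt; case: (msupp P) => // m s /(_ m); rewrite inE eqxx => /(_ isT).
rewrite (mpolyE P) big_seq; elim/big_rec: _ => [|m f mP [Q [r [-> ltr]]]].
  by exists 0, 0; split; [rewrite mul0r addr0|exact: deg_lt0].
suff [Q' [r' [-> ltr']]] : exists Q r, 'X_[m] = Q * D + r /\ deg_lt d r.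
  exists (P@_m *: Q' + Q), (P@_m *: r' + r); split.
    by rewrite -!mul_mpolyC; ring.
  exact/deg_ltD/ltr/deg_ltZ.
have [lt_md|le_dm] := ltnP (m i) d.
  exists 0, 'X_[m]; rewrite mul0r add0r; split=> //.
  by apply: deg_ltW (@deg_ltX m).
(* Modulo [D], the factor ['X_i ^+ d] of ['X_[m]] becomes [- (D - 'X_i ^+ d)], of degree below [d]
   in ['X_i]. This lowers the degree, so the induction hypothesis applies. *)
pose m' := (m - U_(i) *+ d)%MM; have md : m = (m' + U_(i) *+ d)%MM.
  apply/mnmP => j; rewrite mnmDE mnmBE mulmnE mnm1E.
  by case: eqP => [<-|_]; rewrite ?mul1n ?mul0n ?subn0 ?addn0 ?subnK.
have [|Q' [r' [e ltr']]] := IHk ('X_[m'] * (D - 'X_i ^+ d)).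
  have m'i : (m' i + d = m i)%N by rewrite [in RHS]md mnmDE mulmnE mnm1E eqxx mul1n.
  apply: (deg_ltW _ (deg_ltM (@deg_ltX m') ltD)).
  by rewrite m'i -ltnS; apply: ltP.
exists ('X_[m'] - Q'), (- r'); split; last exact: deg_ltN.
rewrite [in LHS]md mpolyXD -mpolyXn.
by rewrite mulrBl -addrA -opprD -e mulrBr opprB addrC subrK.
Qed.

End DegreeInOneVariable.

Lemma sum_ord4 (G : 'I_4 -> nat) :
  (\sum_(i < 4) G i = G 0%R + G 1%R + G 2%:R%R + G 3%:R%R)%N.
Proof.
rewrite !big_ord_recr big_ord0 /= add0n.
by congr (G _ + G _ + G _ + G _)%N; apply: val_inj.
Qed.

Section NormalForms.

Variables (F : fieldType) (p : nat) (p_gt0 : (0 < p)%N).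
Variables (b : 4.-tuple {mpoly F[3]}) (c : F) (c_neq0 : c != 0).

(** The exponents of x, y^p, y^(p+1) and z^(p^2), to be the lead monomials of x, N_G(y), h and
    N_G(z). In the application [c] is [gamma23], the lead coefficient of h. *)
Definition gen_expo : 4.-tuple 'X_{1..3} :=
  [tuple U_(0%R); U_(1%R) *+ p; U_(1%R) *+ p.+1; U_(2%:R%R) *+ (p ^ 2)]%MM.

Definition gen_lead : 4.-tuple F := [tuple 1; 1; c; 1].

Hypothesis b_lead : forall i, has_lead (tnth b i) (tnth gen_expo i) (tnth gen_lead i).
Hypothesis b_x : tnth b 0 = vx F.

Definition expo (I : 'X_{1..4}) : 'X_{1..3} :=
  (\sum_(i < 4) tnth gen_expo i *+ I i)%MM.

Lemma expoE I : [/\ expo I 0 = I 0,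
  expo I 1 = (p * (I 1%R + I 2%:R%R) + I 2%:R%R)%N &
  expo I 2%:R = (p ^ 2 * I 3%:R%R)%N].
Proof.
have E j : expo I j = (tnth gen_expo 0%R j * I 0%R + tnth gen_expo 1%R j * I 1%R +
    tnth gen_expo 2%:R%R j * I 2%:R%R + tnth gen_expo 3%:R%R j * I 3%:R%R)%N.
  rewrite /expo mnm_sumE -(sum_ord4 (fun i => tnth gen_expo i j * I i)%N).
  by apply: eq_bigr => i _; exact: mulmnE.
rewrite !E !(tnth_nth 0%MM) /= !mulmnE !mnm1E -!val_eqE /= {E}.
by clear c_neq0 p_gt0; split; nia.
Qed.

(** Entries 0 and 3 are read off from the exponents of x and z. The exponent of y is
    [p * (I 1 + I 2) + I 2]: its remainder modulo [p] is [I 2], and its quotient then gives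
    [I 1]. *)
Lemma expo_inj (I J : 'X_{1..4}) : (I 2%:R%R < p)%N -> (J 2%:R%R < p)%N ->
  expo I = expo J -> I = J.
Proof.
move=> ltI ltJ e; have [I0 I1 I2] := expoE I; have [J0 J1 J2] := expoE J.
rewrite e in I0 I1 I2; rewrite {}I0 in J0; rewrite {}I1 in J1; rewrite {}I2 in J2.
have e2 : I 2%:R%R = J 2%:R%R.
  by move/(congr1 (modn^~ p)): J1; rewrite /= ![(p * _)%N]mulnC !modnMDl !modn_small.
have e1 : I 1%R = J 1%R.
  by move/eqP: J1; rewrite e2 eqn_add2r eqn_pmul2l // eqn_add2r => /eqP.
have e3 : I 3%:R%R = J 3%:R%R.
  by move/eqP: J2; rewrite eqn_pmul2l ?expn_gt0 ?p_gt0 // => /eqP.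
apply/mnmP; case=> [[|[|[|[|//]]]]] lt_i.
- by rewrite [Ordinal _](_ : _ = 0%R) //; apply: val_inj.
- by rewrite [Ordinal _](_ : _ = 1%R) //; apply: val_inj.
- by rewrite [Ordinal _](_ : _ = 2%:R%R) //; apply: val_inj.
- by rewrite [Ordinal _](_ : _ = 3%:R%R) //; apply: val_inj.
Qed.

Definition expo_coef (I : 'X_{1..4}) : F := \prod_(i < 4) tnth gen_lead i ^+ I i.

Lemma expo_coef_neq0 I : expo_coef I != 0.
Proof.
apply/prodf_neq0 => i _; apply: expf_neq0; rewrite (tnth_nth 0).
by case: i => [[|[|[|[|//]]]]] lt_i //=; apply: oner_neq0.
Qed.

Lemma bprod_lead I : has_lead (bprod b I) (expo I) (expo_coef I).
Proof. by apply: has_lead_prod => i; apply: has_lead_exp. Qed.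

Lemma comp_bprod P : P \mPo b = \sum_(I <- msupp P) P@_I *: bprod b I.
Proof. by rewrite comp_mpolyE. Qed.

Lemma lead_mon_bprod (a : F) I : a != 0 -> lead_mon (a *: bprod b I) = expo I.
Proof.
move=> a0; apply: has_lead_lead_mon (has_leadZ (@bprod_lead I)) _.
by rewrite mulf_neq0 ?expo_coef_neq0.
Qed.

(* A normal form is an [r] with [deg_lt 2%:R p r]: by [expo_inj] the products
   [b^I] occurring in it have distinct lead monomials. *)
Lemma normal_lead r : r != 0 -> deg_lt 2%:R p r ->
  exists2 I, I \in msupp r & has_lead (r \mPo b) (expo I) (r@_I * expo_coef I).
Proof.
move=> r0 ltr; rewrite comp_bprod.
apply: (has_lead_sum_inj (G := fun I => r@_I *: bprod b I) (e := expo)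
  (c := fun I => r@_I * expo_coef I)).
- exact: msupp_uniq.
- by rewrite msupp_eq0.
- by move=> I J /ltr ltI /ltr ltJ; apply: expo_inj.
- by move=> I _; apply/has_leadZ/bprod_lead.
Qed.

Lemma normal_eq0 r : deg_lt 2%:R p r -> r \mPo b = 0 -> r = 0.
Proof.
move=> ltr rb; apply/eqP; apply: contraTT isT => r0.
have [I Ir lr] := normal_lead r0 ltr.
have := has_lead_neq0 lr _; rewrite rb eqxx; apply.
by rewrite mulf_neq0 ?expo_coef_neq0 // -mcoeff_msupp.
Qed.

(** Split [r] into ['X_0 * r1] and a part [r0] free of ['X_0]. The value of [r0] at [b] is divisible
    by x, hence so is its lead monomial if it is nonzero; but this monomial is some [expo I] with
    [I 0 = 0]. So [r0 = 0], and [r1] is the quotient. *)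
Lemma normal_div_x r g : deg_lt 2%:R p r -> r \mPo b = vx F * g ->
  exists r', deg_lt 2%:R p r' /\ g = r' \mPo b.
Proof.
move=> ltr rb.
pose r1 := \sum_(I <- msupp r | (0 < I 0%R)%N) r@_I *: 'X_[I - U_(0%R)]%MM.
pose r0 := \sum_(I <- msupp r | ~~ (0 < I 0%R)%N) r@_I *: 'X_[I].
have def_r : r = 'X_0 * r1 + r0.
  rewrite [LHS]mpolyE (bigID (fun I : 'X_{1..4} => (0 < I 0%R)%N)) /=; congr (_ + _).
  rewrite mulr_sumr; apply: eq_bigr => I I0; rewrite -scalerAr -mpolyXD.
  congr (_ *: 'X_[_]); apply/mnmP => j; rewrite mnmDE mnmBE mnm1E.
  by case: eqP => [<-|_]; rewrite ?add1n ?subn1 ?prednK ?subn0.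
have lt1 : deg_lt 2%:R p r1.
  rewrite /r1 -big_filter; apply: deg_lt_sum => I; rewrite mem_filter => /andP[_ /ltr ltI].
  apply: deg_ltZ => m; rewrite msuppX inE => /eqP->; rewrite mnmBE.
  exact: leq_ltn_trans (leq_subr _ _) ltI.
have lt0 : deg_lt 2%:R p r0.
  rewrite /r0 -big_filter; apply: deg_lt_sum => I; rewrite mem_filter => /andP[_ /ltr ltI].
  by apply: deg_ltZ => m; rewrite msuppX inE => /eqP->.
have r0_supp : forall I : 'X_{1..4}, I \in msupp r0 -> I 0%R = 0%N.
  suff : deg_lt 0 1 r0 by move=> lt I /lt; rewrite ltnS leqn0 => /eqP.
  rewrite /r0 -big_filter; apply: deg_lt_sum => I; rewrite mem_filter => /andP[I0 _].
  by apply: deg_ltZ => m; rewrite msuppX inE => /eqP->; rewrite ltnS leqNgt.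
have x0 : vx F != 0.
  by rewrite -(msupp_eq0) msuppX.
have comp_r : r0 \mPo b = vx F * (g - (r1 \mPo b)).
  rewrite mulrBr -rb [in RHS]def_r comp_mpolyD rmorphM /= comp_mpolyXU.
  by rewrite -(tnth_nth 0 b 0) b_x; ring.
suff r0_eq0 : r0 = 0.
  exists r1; split=> //; move/eqP: comp_r; rewrite r0_eq0 comp_mpoly0 eq_sym mulf_eq0.
  by rewrite (negbTE x0) subr_eq0 => /eqP.
apply/eqP; apply: contraTT isT => r0_neq0.
have [I Ir0 lr0] := normal_lead r0_neq0 lt0.
have c0 : r0@_I * expo_coef I != 0 by rewrite mulf_neq0 ?expo_coef_neq0 // -mcoeff_msupp.
have := has_lead_lead_mon lr0 c0; have := has_lead_neq0 lr0 c0; rewrite comp_r.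
rewrite mulf_eq0 negb_or x0 /= => g0; rewrite lead_monM //.
have -> : lead_mon (vx F) = U_(0%R)%MM.
  by apply: has_lead_lead_mon (@has_leadX _ _ _) (oner_neq0 _).
move/(congr1 (fun m : 'X_{1..3} => m 0%R)); have [-> _ _] := expoE I.
by rewrite mnmDE mnm1E eqxx r0_supp.
Qed.

Lemma normal_div_xn k r g : deg_lt 2%:R p r -> r \mPo b = vx F ^+ k * g ->
  exists r', deg_lt 2%:R p r' /\ g = r' \mPo b.
Proof.
elim: k g => [|k IHk] g ltr; first by rewrite mul1r; exists r.
rewrite exprSr -mulrA => /(IHk _ ltr)[r' [ltr' /esym]]; exact: normal_div_x.
Qed.

(** By induction on the number of terms: one term of [r] carries the lead term of [r \mPo b], and
    subtracting it leaves a normal form with one term less. *)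
Lemma normal_subducts0 r : deg_lt 2%:R p r -> subducts0 b (r \mPo b) r.
Proof.
have [k] := ubnP (size (msupp r)); elim: k r => // k IHk r ltk ltr.
have [->|r0] := eqVneq r 0; first by rewrite comp_mpoly0; apply: subducts0_nil.
have [I Ir lr] := normal_lead r0 ltr; have rI : r@_I != 0 by rewrite -mcoeff_msupp.
have c0 : r@_I * expo_coef I != 0 by rewrite mulf_neq0 ?expo_coef_neq0.
rewrite -{2}[r](subrK (r@_I *: 'X_[I])) addrC.
apply: subducts0_step; first exact: has_lead_neq0 lr c0.
  rewrite /lead_term (has_lead_lead_mon lr) // lead_mon_bprod //.
  by rewrite (has_lead_coef lr) mcoeffZ (has_lead_coef (@bprod_lead I)).
rewrite -[bprod b I]comp_mpolyX -comp_mpolyZ -comp_mpolyB; apply: IHk.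
  rewrite (perm_size (msupp_rem _ _)) size_rem //.
  by case: (msupp r) Ir ltk => //= J s _; rewrite ltnS.
by move=> J; rewrite (perm_mem (msupp_rem r I)) => /mem_rem/ltr.
Qed.

Lemma subducts0_comp f S : subducts0 b f S -> f = S \mPo b.
Proof.
elim=> [|g a I T _ _ _ e]; first by rewrite comp_mpoly0.
by rewrite comp_mpolyD comp_mpolyZ comp_mpolyX -e addrC subrK.
Qed.

(** Each recorded product has the lead monomial of the current polynomial, and a subtraction step
    introduces no monomial above it. *)
Lemma subducts0_supp f S m : subducts0 b f S -> supp_lt f m ->
  {in msupp S, forall I, grevlex_lt (expo I) m}.
Proof.
elim=> [|g a I T g0 e _ IH] ltg J; first by rewrite msupp0.
have lg := lead_mon_has_lead g0.
(* With [a = 0] the subtracted multiple would have lead term 0, whereas [g] is nonzero. *)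
have a0 : a != 0.
  apply: contraTneq (g0) => a0; move: e; rewrite a0 scale0r {1}/lead_term mcoeff0 scale0r.
  move/esym/eqP; rewrite /lead_term -mul_mpolyC mulf_eq0 mpolyC_eq0.
  by rewrite (negbTE (lead_coef_neq0 g0)) /= -[X in is_true X -> _]msupp_eq0 msuppX.
have eI : expo I = lead_mon g.
  rewrite -(lead_mon_bprod I a0); move/(congr1 (@lead_mon F 3)): e.
  rewrite /lead_term !(has_lead_lead_mon (has_leadZ (@has_leadX _ _ _))) // mulr1.
    exact: lead_coef_neq0.
  by rewrite lead_mon_bprod // mcoeffZ (has_lead_coef (@bprod_lead I)) mulf_neq0 ?expo_coef_neq0.
have ltI : grevlex_lt (expo I) m.
  by rewrite eI; apply: ltg; have [] := lead_monP g0.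
move/msuppD_le; rewrite mem_cat => /orP[/msuppZ_le|].
  by rewrite msuppX inE => /eqP->.
by apply: IH; apply/supp_ltB/supp_ltZ/(has_lead_lt (@bprod_lead I)).
Qed.

(** Dividing a relation by [S], which is monic of degree [p] in ['X_2], leaves a normal form that
    vanishes at [b], hence is 0. *)
Lemma normal_relation S : deg_lt 2%:R p (S - 'X_(2%:R) ^+ p) -> S \mPo b = 0 ->
  relation_ideal_generated_by b S.
Proof.
move=> ltS Sb P; split=> [Pb|[Q ->]]; last by rewrite rmorphM /= Sb mulr0.
have [Q [r [e ltr]]] := deg_lt_division P ltS; exists Q.
suff r0 : r = 0 by rewrite e r0 addr0.
by apply: normal_eq0 => //; move: Pb; rewrite e comp_mpolyD rmorphM /= Sb mulr0 add0r.
Qed.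

End NormalForms.

(** * Translations of univariate polynomials *)

Section Shift.

Variables (R : idomainType) (u : R).
Implicit Types (q : {poly R}) (k : nat).

Definition shift q := q \Po ('X + u%:P).

(** For [k > n] the truncated exponent [n - k] is harmless, as the binomial coefficient is 0. *)
Lemma coef_XaddC_exp n k :
  (('X + u%:P) ^+ n)`_k = u ^+ (n - k) *+ 'C(n, k).
Proof.
rewrite addrC exprDn coef_sum.
under eq_bigr => i _ do rewrite coefMn -polyC_exp coefCM coefXn.
have [lt_nk|le_kn] := ltnP n k.
  rewrite bin_small // mulr0n big1 // => i _.
  rewrite (_ : (k == i) = false) ?mulr0 ?mul0rn //.
  by apply/eqP => ki; have := ltn_ord i; rewrite -ki ltnS leqNgt lt_nk.
rewrite (bigD1 (Ordinal (_ : k < n.+1)%N)) //= eqxx mulr1 big1 ?addr0 // => i.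
by rewrite -val_eqE /= eq_sym => /negbTE->; rewrite mulr0 mul0rn.
Qed.

Lemma coef_shift m q k : (size q <= m)%N ->
  (shift q)`_k = \sum_(i < m) q`_i * u ^+ (i - k) *+ 'C(i, k).
Proof.
move=> le_qm; rewrite coef_comp_poly.
rewrite (big_ord_widen m (fun i => q`_i * (('X + u%:P) ^+ i)`_k)) // big_mkcond.
apply: eq_bigr => i _; rewrite coef_XaddC_exp mulrnAr; case: ltnP => // le_qi.
by rewrite nth_default // mul0r mul0rn.
Qed.

Lemma coef_shift_top q k : (size q <= k.+1)%N -> (shift q)`_k = q`_k.
Proof.
move=> le_q; rewrite (coef_shift _ le_q) big_ord_recr /= subnn mulr1 binn mulr1n.
by rewrite big1 ?add0r // => i _; rewrite bin_small ?ltn_ord.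
Qed.

Lemma coef_shift_next q k : (size q <= k.+2)%N ->
  (shift q)`_k = q`_k + q`_k.+1 * u *+ k.+1.
Proof.
move=> le_q; rewrite (coef_shift _ le_q) !big_ord_recr /= subnn mulr1 binn mulr1n.
rewrite subSnn expr1 binSn.
by rewrite big1 ?add0r // => i _; rewrite bin_small ?ltn_ord.
Qed.

(** If [q] has degree [k.+1], the translation changes the coefficient of degree [k] by [k.+1] times
    [u] times the lead coefficient. Invariance forces [k.+1] to vanish in [R]. *)
Lemma shift_inv_dvdn p q : p \in [pchar R] -> u != 0 -> shift q = q ->
  (p %| (size q).-1)%N.
Proof.
move=> charR u0 sq; case def_n: (size q).-1 => [|k]; first exact: dvdn0.
have q0 : q`_k.+1 != 0.
  rewrite -def_n -lead_coefE lead_coef_eq0.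
  by apply: contra_eqN def_n => /eqP->; rewrite size_poly0.
have le_q : (size q <= k.+2)%N by rewrite -def_n; case: (size q).
move/eqP: (coef_shift_next le_q).
rewrite sq -{1}[q`_k]addr0 (inj_eq (addrI _)) eq_sym -mulr_natr.
by rewrite !mulf_eq0 (negbTE q0) (negbTE u0) /= -(dvdn_pcharf charR).
Qed.

Lemma size_le_drop q k : (size q <= k.+1)%N -> q`_k = 0 -> (size q <= k)%N.
Proof.
move=> le_q qk; apply/leq_sizeP => j; rewrite leq_eqVlt => /orP[/eqP<-//|lt_kj].
by apply: nth_default; apply: leq_trans lt_kj.
Qed.

(** The degree of [a] is a multiple [p * m], so subtracting [lead_coef a] times [N ^+ m] lowers it
    and preserves invariance. *)
Lemma shift_inv_comp p N a : p \in [pchar R] -> u != 0 ->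
  N \is monic -> size N = p.+1 -> shift N = N -> shift a = a ->
  exists Q, a = Q \Po N.
Proof.
move=> charR u0 monN szN sN; have [k] := ubnP (size a).
elim: k a => // k IHk a; rewrite ltnS => le_ak sa.
have [->|a0] := eqVneq a 0; first by exists 0; rewrite comp_poly0.
have /dvdnP[m def_m] := shift_inv_dvdn charR u0 sa.
pose a' := a - (lead_coef a)%:P * N ^+ m.
have monNm : N ^+ m \is monic by apply: monic_exp.
have sa0 : (0 < size a)%N by rewrite size_poly_gt0.
have szNm : size (N ^+ m) = size a.
  rewrite -(prednK sa0) def_m -(@prednK (size (N ^+ m))).
    by rewrite size_exp szN mulnC.
  by rewrite size_poly_gt0 monic_neq0.
have lt_a' : (size a' <= (size a).-1)%N.
  apply: size_le_drop.
    rewrite prednK //; apply: leq_trans (size_polyD _ _) _.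
    rewrite size_polyN geq_max leqnn /= -szNm mul_polyC.
    exact: size_scale_leq.
  rewrite coefB coefCM -[in X in _ - _ * _`_X]szNm -[_`_(size (N ^+ m)).-1]lead_coefE.
  by rewrite (monicP monNm) mulr1 subrr.
have [] := IHk a'.
- by apply: leq_ltn_trans lt_a' _; rewrite prednK.
- by rewrite /a' /shift rmorphB rmorphM rmorphXn /= -!/(shift _) sN sa /shift comp_polyC.
move=> Q def_a'; exists (Q + (lead_coef a)%:P * 'X^m).
rewrite comp_polyD comp_polyM comp_polyC rmorphXn /= comp_polyX -def_a'.
by rewrite subrK.
Qed.

End Shift.

(** * The group action *)

Section Minors.

Variables (p : nat) (F : fieldType) (M : 'M[F]_2).

Lemma gamma_mxE (j : 'I_2) :
  [/\ gamma_mx p M 0 j = M 0 j, gamma_mx p M 1 j = M 1 j,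
      gamma_mx p M 2%:R j = M 0 j ^+ p & gamma_mx p M 3%:R j = M 1 j ^+ p].
Proof.
rewrite /gamma_mx; split.
- by rewrite -(col_mxEu M (map_mx (fun c => c ^+ p) M)); congr (_ _ _); apply: val_inj.
- by rewrite -(col_mxEu M (map_mx (fun c => c ^+ p) M)); congr (_ _ _); apply: val_inj.
- rewrite (_ : 2%:R = rshift 2 0); first by rewrite col_mxEd mxE.
  exact: val_inj.
- rewrite (_ : 3%:R = rshift 2 1); first by rewrite col_mxEd mxE.
  exact: val_inj.
Qed.

Lemma minor2E i j : minor2 p M i j =
  gamma_mx p M i 0 * gamma_mx p M j 1 - gamma_mx p M i 1 * gamma_mx p M j 0.
Proof.
rewrite /minor2 (expand_det_row _ 0) !big_ord_recl big_ord0 /cofactor !det_mx11 !mxE.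
have l01 (k : 'I_1) : lift (0 : 'I_2) k = 1 by rewrite ord1; apply: val_inj.
have l10 (k : 'I_1) : lift (1 : 'I_2) k = 0 by rewrite ord1; apply: val_inj.
by rewrite l01 l10 !(tnth_nth 0) /= expr0 expr1; ring.
Qed.

Lemma gammaE : [/\ gamma12 p M = M 0 0 * M 1 1 - M 0 1 * M 1 0,
  gamma13 p M = M 0 0 * M 0 1 ^+ p - M 0 1 * M 0 0 ^+ p,
  gamma14 p M = M 0 0 * M 1 1 ^+ p - M 0 1 * M 1 0 ^+ p,
  gamma23 p M = M 1 0 * M 0 1 ^+ p - M 1 1 * M 0 0 ^+ p &
  gamma24 p M = M 1 0 * M 1 1 ^+ p - M 1 1 * M 1 0 ^+ p].
Proof.
rewrite /gamma12 /gamma13 /gamma14 /gamma23 /gamma24 !minor2E.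
have [-> -> -> ->] := gamma_mxE 0; have [-> -> -> ->] := gamma_mxE 1.
by [].
Qed.

End Minors.

Section Group.

Variables (p : nat) (p_prime : prime p) (F : fieldType).
Hypothesis charF : p \in [pchar F].
Variable M : 'M[F]_2.
Hypotheses (gamma12_neq0 : gamma12 p M != 0) (gamma13_eq0 : gamma13 p M = 0).

Local Notation elem_ab := (elem_ab p).

(* [e_1^a e_2^b] acts as [unip c d], where [c] and [d] are the entries of [M (a, b)^T]. *)
Definition actc (g : elem_ab) : F := M 0 0 *+ val g.1 + M 0 1 *+ val g.2.
Definition actd (g : elem_ab) : F := M 1 0 *+ val g.1 + M 1 1 *+ val g.2.

(** The factor by which the third row of [gamma_mx] is a multiple of the first when [gamma13 = 0];
    inserting it in the minor on rows 2 and 3 gives [gamma23 = - (lambda * gamma12)]. *)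
Definition lambda : F := - (gamma23 p M / gamma12 p M).

Let p_gt0 : (0 < p)%N. Proof. exact: prime_gt0. Qed.

Lemma actE f g : VM_act M f g = unip (actc g) (actd g) f.
Proof. exact: VM_actE. Qed.

Lemma exprpD (a b : F) : (a + b) ^+ p = a ^+ p + b ^+ p.
Proof. by rewrite -!(pFrobenius_autE charF) rmorphD. Qed.

Lemma exprpMn (a : F) k : (a *+ k) ^+ p = a ^+ p *+ k.
Proof. by rewrite -!(pFrobenius_autE charF) rmorphMn. Qed.

Lemma gamma23E : gamma23 p M = - (lambda * gamma12 p M).
Proof. by rewrite /lambda mulNr divfK ?opprK. Qed.

(** The first and third rows of [gamma_mx] are proportional, and the p-th power map is additive. *)
Lemma actc_expp g : actc g ^+ p = lambda * actc g.
Proof.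
have [g12 g13 _ g23 _] := gammaE p M; move: gamma13_eq0; rewrite g13 => /subr0_eq e13.
apply: (mulfI gamma12_neq0); rewrite mulrA [_ * lambda]mulrC -[lambda * _]opprK -gamma23E.
by rewrite /actc exprpD !exprpMn g12 g23;  ring: e13.
Qed.

(** Cramer's rule, expanding the fourth row of [gamma_mx] in the basis formed by the first two. *)
Lemma actd_expp g :
  gamma12 p M * actd g ^+ p = gamma14 p M * actd g - gamma24 p M * actc g.
Proof.
have [-> _ -> _ ->] := gammaE p M.
by rewrite /actc /actd exprpD !exprpMn; ring.
Qed.

Lemma actc_expg (g : elem_ab) k : actc (g ^+ k)%g = actc g *+ k.
Proof.
have actcM (a b : elem_ab) : actc (a * b)%g = actc a + actc b.
  case: a b => [a1 a2] [b1 b2].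
  transitivity (M 0 0 *+ val (a1 + b1) + M 0 1 *+ val (a2 + b2)); first by [].
  by rewrite !(mulrn_Zp charF) addrACA.
elim: k => [|k IHk]; last by rewrite expgS actcM IHk mulrS.
by rewrite expg0 /actc /= !mulr0n addr0.
Qed.

Lemma mulrn_inj_p (a : F) i j : a != 0 -> (i < p)%N -> (j < p)%N ->
  a *+ i = a *+ j -> i = j.
Proof.
move=> a0; wlog le_ij : i j / (i <= j)%N => [hw lti ltj e|_ ltj /eqP].
  by case/orP: (leq_total i j) => le; [|apply/esym]; apply: hw.
rewrite eq_sym -subr_eq0 -mulrnBr // -mulr_natr mulf_eq0 (negbTE a0) /=.
rewrite -(dvdn_pcharf charF) /dvdn modn_small; last exact: leq_ltn_trans (leq_subr _ _) ltj.
by rewrite subn_eq0 => le_ji; apply/eqP; rewrite eqn_leq le_ij le_ji.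
Qed.

(** The determinant of [M] is [gamma12], so both components of [g] can be recovered by Cramer's
    rule; they lie below [p], hence are determined by their images in [F]. *)
Lemma actcd_inj : injective (fun g => (actc g, actd g)).
Proof.
move=> [a1 a2] [b1 b2] [ec ed].
have valF_inj (a b : 'Z_p) : (val a)%:R = (val b)%:R :> F -> a = b.
  have lt (z : 'Z_p) : (val z < p)%N.
    by rewrite -[X in (_ < X)%N](Zp_cast (prime_gt1 p_prime)) ltn_ord.
  by move/(mulrn_inj_p (oner_neq0 F) (lt a) (lt b)); apply: val_inj.
have [g12 _ _ _ _] := gammaE p M.
move: ec ed; rewrite /actc /actd /= => ec ed.
congr (_, _); apply: valF_inj; apply: (mulfI gamma12_neq0); rewrite g12.
- transitivity (M 1 1 * (M 0 0 *+ a1 + M 0 1 *+ a2) - M 0 1 * (M 1 0 *+ a1 + M 1 1 *+ a2)).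
    by ring.
  by rewrite ec ed; ring.
transitivity (M 0 0 * (M 1 0 *+ a1 + M 1 1 *+ a2) - M 1 0 * (M 0 0 *+ a1 + M 0 1 *+ a2)).
  by ring.
by rewrite ec ed; ring.
Qed.

Lemma actc_neq0 : exists g, actc g != 0.
Proof.
have p1 := prime_gt1 p_prime.
have v1 : val (1%R : 'Z_p) = 1%N by [].
have [e|] := eqVneq (M 0 0) 0; last first.
  by exists (1%R, 0%R); rewrite /actc v1 mulr1n mulr0n addr0.
exists (0%R, 1%R); rewrite /actc v1 mulr1n mulr0n add0r.
by apply: contraNneq gamma12_neq0 => e1; have [-> _ _ _ _] := gammaE p M; rewrite e e1 !mul0r subr0.
Qed.

Lemma lambda_neq0 : lambda != 0.
Proof.
have [g g0] := actc_neq0; apply: contraNneq g0 => l0.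
have := actc_expp g; rewrite l0 mul0r => /eqP.
by rewrite expf_eq0 p_gt0.
Qed.

Lemma card_elem_ab : #|{: elem_ab}| = (p ^ 2)%N.
Proof. by rewrite card_prod card_ord Zp_cast ?prime_gt1 // mulnn. Qed.

(** At most [p] values, since all are roots of ['X^p - lambda *: 'X]; at least [p], since the
    multiples of one nonzero value are values too. *)
Lemma size_actc : size (undup [seq actc g | g : elem_ab]) = p.
Proof.
set s := undup _; apply/eqP; rewrite eqn_leq; apply/andP; split.
  have szq : size ('X^p - lambda *: 'X : {poly F}) = p.+1.
    rewrite size_polyDl size_polyXn // size_polyN.
    apply: leq_ltn_trans (size_scale_leq _ _) _.
    by rewrite size_polyX ltnS prime_gt1.
  rewrite -ltnS -szq; apply: max_poly_roots.
  - by rewrite -size_poly_eq0 szq.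
  - apply/allP => a; rewrite mem_undup => /mapP[g _ ->].
    by rewrite rootE !hornerE actc_expp subrr.
  - exact: undup_uniq.
have [g g0] := actc_neq0.
rewrite -[X in (X <= _)%N](size_iota 0 p) -(size_map (fun k => actc g *+ k)).
apply: uniq_leq_size.
  rewrite map_inj_in_uniq ?iota_uniq // => i j; rewrite !mem_iota => lti ltj.
  exact: mulrn_inj_p.
move=> _ /mapP[k _ ->]; rewrite mem_undup -actc_expg.
by apply/mapP; exists (g ^+ k)%g => //; rewrite mem_enum.
Qed.

(** The p^2 group elements have only [p] values of [actc], so two of them share it. They differ in
    [actd] by [actcd_inj], and the action of one followed by the inverse of the other is the
    required translation. *)
Lemma exists_pure_shift : exists2 d, d != 0 &
  forall f, f \in VM_invariants p M -> unip 0 d f = f.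
Proof.
have [inj_c|/injectivePn[g [h gh ec]]] := boolP (injectiveb actc).
  have := size_actc; rewrite undup_id; last first.
    by rewrite map_inj_uniq ?enum_uniq //; apply/injectiveP.
  rewrite size_map -cardE card_elem_ab => /eqP.
  by rewrite -[X in _ == X]expn1 eqn_exp2l ?prime_gt1.
exists (actd g - actd h).
  rewrite subr_eq0; apply: contra gh => /eqP ed; apply/eqP/actcd_inj.
  by rewrite ec ed.
move=> f /forallP inv_f; move/eqP: (inv_f g); move/eqP: (inv_f h); rewrite !actE => eh eg.
have inv_h : unip (- actc h) (- actd h) f = f.
  by rewrite -[in LHS]eh unip_comp !subrr unip0.
by rewrite -[0](subrr (actc h)) -[X in unip (X - _)]ec -unip_comp eg.
Qed.

End Group.

(** * The generators *)

Section Generators.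

Variables (p : nat) (p_prime : prime p) (p_gt2 : (2 < p)%N) (F : fieldType).
Hypothesis charF : p \in [pchar F].
Variable M : 'M[F]_2.
Hypotheses (gamma12_neq0 : gamma12 p M != 0) (gamma13_eq0 : gamma13 p M = 0).

Local Notation elem_ab := (elem_ab p).
Local Notation x := (vx F).
Local Notation y := (vy F).
Local Notation z := (vz F).
Local Notation b := (VM_gens p M).
Local Notation actc := (actc (p := p) M).
Local Notation actd := (actd (p := p) M).
Local Notation lambda := (lambda p M).

Lemma mem_invariants f : (f \in VM_invariants p M) <->
  (forall g : elem_ab, unip (actc g) (actd g) f = f).
Proof.
split=> [/forallP inv_f g|inv_f]; first by rewrite -actE; apply/eqP.
by apply/forallP => g; rewrite actE inv_f.
Qed.

Lemma unip_vars c d : [/\ unip c d x = x, unip c d y = y + c *: x &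
  unip c d z = z + (c *+ 2) *: y + (c ^+ 2 + d) *: x].
Proof. by rewrite /unip !comp_mpolyXU. Qed.

(** A group element acts injectively and maps the finite orbit into itself, so it permutes the
    factors. *)
Lemma orbit_product_invariant f : orbit_product p M f \in VM_invariants p M.
Proof.
apply/mem_invariants => g; set s := undup [seq VM_act M f h | h : elem_ab].
have act_inj (h : elem_ab) : injective (fun f => VM_act M f h).
  by have [/(_ h)] := VM_act_action M charF.
rewrite -actE /orbit_product -/s actE /unip rmorph_prod /=.
under eq_bigr => u _ do rewrite -/(unip _ _ u) -actE.
rewrite -(big_map (fun u => VM_act M u g) xpredT id); apply: perm_big.
have uniq_s : uniq [seq VM_act M u g | u <- s].
  by rewrite map_inj_uniq ?undup_uniq //; apply: act_inj.
have sub_s : {subset [seq VM_act M u g | u <- s] <= s}.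
  move=> _ /mapP[u us ->]; move: us; rewrite !mem_undup => /mapP[h _ ->].
  by rewrite -VM_actM //; apply/mapP; exists (h * g)%g; rewrite ?mem_enum.
have [|_ eq_s] := uniq_min_size uniq_s sub_s; first by rewrite size_map.
by apply: uniq_perm; rewrite ?undup_uniq.
Qed.

(** As [y + a *: x] determines [a], duplicates may be removed among the values of [actc] instead of
    among the conjugates. *)
Lemma orbit_yE : orbit_product p M y =
  \prod_(a <- undup [seq actc g | g : elem_ab]) (y + a *: x).
Proof.
rewrite /orbit_product.
have -> : [seq VM_act M y g | g : elem_ab] =
    [seq y + a *: x | a <- [seq actc g | g : elem_ab]].
  rewrite -map_comp; apply: eq_map => g /=; rewrite actE.
  by have [_ -> _] := unip_vars (actc g) (actd g).
rewrite undup_map_inj ?big_map // => a a' /addrI /eqP.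
rewrite -subr_eq0 -scalerBl -mul_mpolyC mulf_eq0 mpolyC_eq0 subr_eq0.
by rewrite -[vx F == 0]msupp_eq0 msuppX orbF => /eqP.
Qed.

(** The conjugates of z are pairwise distinct: the coefficient of y gives [actc g], as 2 is
    invertible, and then that of x gives [actd g]. *)
Lemma orbit_zE : orbit_product p M z =
  \prod_(g <- enum {: elem_ab})
    (z + ((actc g *+ 2) *: y + (actc g ^+ 2 + actd g) *: x)).
Proof.
rewrite /orbit_product undup_id.
  rewrite big_map; apply: eq_bigr => g _; rewrite actE addrA.
  by have [_ _ ->] := unip_vars (actc g) (actd g).
rewrite map_inj_uniq ?enum_uniq // => g h; rewrite !actE.
have [_ _ ->] := unip_vars (actc g) (actd g).
have [_ _ ->] := unip_vars (actc h) (actd h).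
rewrite -!addrA => /addrI e; apply: (actcd_inj p_prime charF gamma12_neq0).
have ec : actc g = actc h.
  have := congr1 (mcoeff U_(1%R)%MM) e.
  rewrite !(mcoeffD, mcoeffZ, mcoeffXU) /= !mulr1 !mulr0 !addr0 => /eqP.
  rewrite -subr_eq0 -mulrnBl -mulr_natr mulf_eq0 -(dvdn_pcharf charF).
  by rewrite gtnNdvd // orbF subr_eq0 => /eqP.
have := congr1 (mcoeff U_(0%R)%MM) e.
rewrite !(mcoeffD, mcoeffZ, mcoeffXU) /= !mulr1 !mulr0 !add0r ec.
by move/addrI => ->.
Qed.

Lemma natr2_neq0 : 2%:R != 0 :> F.
Proof. by rewrite -(dvdn_pcharf charF) gtnNdvd. Qed.

Lemma mpoly_exprpD (f g : {mpoly F[3]}) : (f + g) ^+ p = f ^+ p + g ^+ p.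
Proof.
have charP : p \in [pchar {mpoly F[3]}].
  by rewrite inE p_prime -mpolyC_nat (pcharf0 charF) mpolyC0 eqxx.
by rewrite -!(pFrobenius_autE charP) rmorphD.
Qed.

(** Normalized so that x z^p has coefficient 1 in the bracket, with [gamma23] expressed through
    [lambda]; this matches the formulas for the p-th powers of [actc g] and [actd g]. *)
Lemma hinvE : hinv p M = (gamma12 p M / 2%:R) *:
  (x * z ^+ p - (lambda *+ 2) *: y ^+ p.+1
   + x ^+ p.-1 * ((gamma14 p M / gamma12 p M) *: delta F + lambda ^+ 2 *: y ^+ 2)
   + (gamma24 p M / gamma12 p M) *: (y * x ^+ p)).
Proof.
have k12 : gamma12 p M = 2%:R * (gamma12 p M / 2%:R).
  by rewrite mulrC divfK ?natr2_neq0.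
have e14 := divfK gamma12_neq0 (gamma14 p M).
have e24 := divfK gamma12_neq0 (gamma24 p M).
have e23 : gamma23 p M ^+ 2 / gamma12 p M = lambda ^+ 2 * gamma12 p M.
  rewrite (gamma23E gamma12_neq0) sqrrN exprMn -mulrA [_ ^+ 2 / _]mulrC expr2.
  by rewrite mulKf.
rewrite /hinv e23 (gamma23E gamma12_neq0).
move: e14 e24 k12; set k := _ / 2%:R; set g14 := gamma14 p M / _.
set g24 := gamma24 p M / _ => <- <- ->.
apply: (scalerI natr2_neq0); rewrite scalerDr.
rewrite [2%:R *: (_^-1 *: _)]scalerA mulfV ?natr2_neq0 // scale1r.
by rewrite -!mul_mpolyC; ring.
Qed.

(** The p-th power map is additive, and the p-th powers of [actc g] and [actd g] are linear in them.
    After these substitutions a polynomial identity remains. *)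
Lemma hinv_invariant : hinv p M \in VM_invariants p M.
Proof.
apply/mem_invariants => g; rewrite hinvE; set k := gamma12 p M / _.
set g14 := gamma14 p M / _; set g24 := gamma24 p M / _.
have dp : actd g ^+ p = g14 * actd g - g24 * actc g.
  apply: (mulfI gamma12_neq0); rewrite (actd_expp charF) mulrBr.
  by rewrite -[in LHS](divfK gamma12_neq0 (gamma14 p M))
    -[in LHS](divfK gamma12_neq0 (gamma24 p M)) -/g14 -/g24; ring.
have cp := actc_expp charF gamma12_neq0 gamma13_eq0 g.
have [ux uy uz] := unip_vars (actc g) (actd g).
have ccp : (actc g *+ 2) ^+ p = lambda * actc g *+ 2 by rewrite exprpMn // cp.
have cdp : (actc g ^+ 2 + actd g) ^+ p =
    lambda ^+ 2 * actc g ^+ 2 + g14 * actd g - g24 * actc g.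
  by rewrite exprpD // exprAC cp exprMn dp addrA.
move: cp ccp cdp ux uy uz {dp}; set c := actc g; set d := actd g.
set l := lambda => cp ccp cdp ux uy uz.
have yp : (y + c *: x) ^+ p = y ^+ p + (l * c) *: x ^+ p.
  by rewrite mpoly_exprpD exprZn cp.
have zp : (z + (c *+ 2) *: y + (c ^+ 2 + d) *: x) ^+ p =
    z ^+ p + (l * c *+ 2) *: y ^+ p +
    (l ^+ 2 * c ^+ 2 + g14 * d - g24 * c) *: x ^+ p.
  by rewrite !mpoly_exprpD !exprZn ccp cdp.
rewrite /unip comp_mpolyZ; congr (_ *: _).
rewrite /delta; do 3?rewrite !(comp_mpolyD, comp_mpolyN, comp_mpolyZ, rmorphM, rmorphXn) /=.
rewrite -!/(unip c d _) ux uy uz !(exprS _ p). rewrite yp zp.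
(* This leaves [x ^+ p.-1] as the only power of x with a symbolic exponent. *)
have -> : x ^+ p = x * x ^+ p.-1 by rewrite -exprS prednK ?prime_gt0.
by rewrite -!mul_mpolyC; ring.
Qed.

End Generators.

(** * Polynomials in x, y, z as iterated univariate polynomials *)

HB.instance Definition _ (R : idomainType) (u : R) :=
  GRing.RMorphism.copy (shift u) (comp_poly ('X + u%:P)).

Lemma mpoly_rmorph_ext n (F : fieldType) (S : comNzRingType)
    (g1 g2 : {rmorphism {mpoly F[n]} -> S}) :
  (forall a, g1 a%:MP = g2 a%:MP) -> (forall i, g1 'X_i = g2 'X_i) -> g1 =1 g2.
Proof.
move=> eqC eqX f; rewrite (mpolyE f) !rmorph_sum; apply: eq_bigr => m _.
rewrite -mul_mpolyC !rmorphM /= eqC; congr (_ * _).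
by rewrite mpolyXE_id !rmorph_prod; apply: eq_bigr => i _; rewrite !rmorphXn eqX.
Qed.

Section Nested.

Variable F : fieldType.

Definition const3 (a : F) : {poly {poly {poly F}}} := a%:P%:P%:P.

(* The variables become 'X%:P%:P, 'X%:P and 'X, as in F[x][y][z]. *)
Definition nested (f : {mpoly F[3]}) : {poly {poly {poly F}}} :=
  mmap const3 (tnth [tuple 'X%:P%:P; 'X%:P; 'X]) f.

Lemma const3_additive : additive const3.
Proof. by move=> a b; rewrite /const3 !rmorphB. Qed.

Lemma const3_multiplicative : multiplicative const3.
Proof. by split=> [a b|]; rewrite /const3 ?rmorphM ?rmorph1. Qed.

HB.instance Definition _ :=
  GRing.isAdditive.Build F {poly {poly {poly F}}} const3 const3_additive.
HB.instance Definition _ :=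
  GRing.isMultiplicative.Build F {poly {poly {poly F}}} const3 const3_multiplicative.

Lemma nested_additive : additive nested.
Proof. exact: mmap_is_additive. Qed.

Lemma nested_multiplicative : multiplicative nested.
Proof. exact: mmap_is_multiplicative. Qed.

HB.instance Definition _ := GRing.isAdditive.Build
  {mpoly F[3]} {poly {poly {poly F}}} nested nested_additive.
HB.instance Definition _ := GRing.isMultiplicative.Build
  {mpoly F[3]} {poly {poly {poly F}}} nested nested_multiplicative.

Lemma nestedB f g : nested (f - g) = nested f - nested g.
Proof. exact: rmorphB. Qed.

Lemma nestedM f g : nested (f * g) = nested f * nested g.
Proof. exact: rmorphM. Qed.

Lemma nestedXn f k : nested (f ^+ k) = nested f ^+ k.
Proof. exact: rmorphXn. Qed.

Lemma nestedC a : nested a%:MP = a%:P%:P%:P.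
Proof. exact: mmapC. Qed.

Lemma nestedZ a f : nested (a *: f) = a%:P%:P%:P * nested f.
Proof. by rewrite -mul_mpolyC rmorphM /= nestedC. Qed.

Lemma nested_vars : [/\ nested (vx F) = 'X%:P%:P, nested (vy F) = 'X%:P &
  nested (vz F) = 'X].
Proof. by rewrite /nested; split; rewrite mmapX mmap1U. Qed.

Lemma coef_nested f (m : 'X_{1..3}) :
  (nested f)`_(m 2%:R%R)`_(m 1%R)`_(m 0%R) = f@_m.
Proof.
have nestedX a (m' : 'X_{1..3}) : nested (a *: 'X_[m']) =
    ((a%:P * 'X^(m' 0%R))%:P * 'X^(m' 1%R))%:P * 'X^(m' 2%:R%R).
  rewrite nestedZ /nested mmapX /mmap1 !big_ord_recl big_ord0 mulr1 !(tnth_nth 0) /=.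
  rewrite !rmorphM !rmorphXn /= -!mulrA.
  by congr (_ * (_ ^+ m' _ * (_ ^+ m' _ * _ ^+ m' _))); apply: val_inj.
rewrite [in LHS](mpolyE f) rmorph_sum /= !coef_sum [RHS](congr1 (mcoeff m) (mpolyE f)).
rewrite [RHS]raddf_sum; apply: eq_bigr => m' _.
rewrite nestedX /= mcoeffZ mcoeffX coefCM coefXn.
have -> : (m' == m) = [&& m 2%:R%R == m' 2%:R%R, m 1%R == m' 1%R & m 0%R == m' 0%R].
  apply/eqP/and3P => [->//|[/eqP e2 /eqP e1 /eqP e0]]; apply/mnmP.
  case=> [[|[|[|//]]]] lt_i.
  - by rewrite [Ordinal _](_ : _ = 0%R) //; apply: val_inj.
  - by rewrite [Ordinal _](_ : _ = 1%R) //; apply: val_inj.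
  - by rewrite [Ordinal _](_ : _ = 2%:R%R) //; apply: val_inj.
case: (m 2%:R%R == _) => /=; last by rewrite !mulr0 !coef0.
rewrite mulr1 coefCM coefXn.
case: (m 1%R == _) => /=; last by rewrite !mulr0 coef0.
by rewrite mulr1 coefCM coefXn.
Qed.

Lemma nested_inj : injective nested.
Proof. by move=> f g e; apply/mpolyP => m; rewrite -!coef_nested e. Qed.

(** Both sides are ring morphisms in [f] that agree on constants and variables. The inner [shift]
    translates y in the coefficients and the outer one translates z, so the results on [shift] apply
    to each. *)
Lemma nested_unip c d f : nested (unip c d f) =
  shift ((c *+ 2)%:P%:P * 'X + ((c ^+ 2 + d) *: 'X)%:P)
    (map_poly (shift (c *: 'X)) (nested f)).
Proof.
set u := _ * 'X + _.
pose t := [tuple vx F; vy F + c *: vx F;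
     vz F + (c *+ 2) *: vy F + (c ^+ 2 + d) *: vx F].
have shiftC (R : idomainType) (v a : R) : shift v a%:P = a%:P by apply: comp_polyC.
have shiftX (R : idomainType) (v : R) : shift v 'X = 'X + v%:P by apply: comp_polyX.
apply: (@mpoly_rmorph_ext 3 F _ (nested \o comp_mpoly t)
  (shift u \o map_poly (shift (c *: 'X)) \o nested)) => [a|i] /=.
  by rewrite comp_mpolyC nestedC map_polyC /= !shiftC.
have [nx ny nz] := nested_vars; rewrite comp_mpolyXU.
case: i => [[|[|[|//]]]] lt_i /=.
- rewrite (_ : 'X_(Ordinal lt_i) = vx F); last by congr 'X_ _; apply: val_inj.
  by rewrite nx map_polyC /= !shiftC.
- rewrite (_ : 'X_(Ordinal lt_i) = vy F); last by congr 'X_ _; apply: val_inj.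
  rewrite rmorphD /= nestedZ ny nx map_polyC shiftC /= shiftX.
  by rewrite -!rmorphM -rmorphD /= mul_polyC.
rewrite (_ : 'X_(Ordinal lt_i) = vz F); last by congr 'X_ _; apply: val_inj.
rewrite !rmorphD /= !nestedZ nz ny nx map_polyX shiftX /u.
by rewrite -!rmorphM /= -addrA -mul_polyC !rmorphD /= !rmorphM.
Qed.

End Nested.

(** * Lead monomials of the generators *)

Section Leads.

Lemma grevlex_lt_x n (m1 m2 : 'X_{1..n.+1}) :
  mdeg m1 = mdeg m2 -> (m2 0%R < m1 0%R)%N -> grevlex_lt m1 m2.
Proof.
move=> e lt0; rewrite /grevlex_lt e eqxx ltnn /=; apply/existsP; exists 0.
by rewrite lt0; apply/forallP => j; rewrite ltn0.
Qed.

Lemma grevlex_lt_yz : grevlex_lt (U_(1%R) : 'X_{1..3})%MM U_(2%:R%R)%MM.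
Proof.
rewrite /grevlex_lt !mdeg1 /=; apply/existsP; exists 1; rewrite !mnm1E /=.
by apply/forallP => j; apply/implyP; rewrite !mnm1E; case: j => [[|[|[|]]]].
Qed.

Variable F : fieldType.

Lemma has_lead_prod_const n (I : Type) (r : seq I) (G : I -> {mpoly F[n]}) m :
  (forall i, has_lead (G i) m 1) -> has_lead (\prod_(i <- r) G i) (m *+ size r)%MM 1.
Proof.
move=> lG; elim: r => [|i r IHr] /=.
  by rewrite big_nil mulm0n; apply: has_lead1.
by rewrite big_cons mulmS; have := has_leadM (lG i) IHr; rewrite mulr1.
Qed.

Variables (p : nat) (p_prime : prime p) (p_gt2 : (2 < p)%N).
Hypothesis charF : p \in [pchar F].
Variable M : 'M[F]_2.
Hypotheses (gamma12_neq0 : gamma12 p M != 0) (gamma13_eq0 : gamma13 p M = 0).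

Lemma orbit_y_lead : has_lead (orbit_product p M (vy F)) (U_(1%R) *+ p)%MM 1.
Proof.
rewrite orbit_yE -[in (_ *+ p)%MM](size_actc p_prime charF gamma12_neq0 gamma13_eq0).
apply: has_lead_prod_const => a; apply: has_leadDl (@has_leadX _ _ _) _.
by apply/supp_ltZ/supp_ltX/grevlex_lt_x; rewrite ?mdeg1 ?mnm1E.
Qed.

Lemma orbit_z_lead : has_lead (orbit_product p M (vz F)) (U_(2%:R%R) *+ p ^ 2)%MM 1.
Proof.
rewrite (orbit_zE p_prime p_gt2 charF gamma12_neq0) -(card_elem_ab p_prime) cardE.
apply: has_lead_prod_const => g; apply: has_leadDl (@has_leadX _ _ _) _.
apply: supp_ltD; apply/supp_ltZ/supp_ltX; first exact: grevlex_lt_yz.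
by apply: grevlex_lt_x; rewrite ?mdeg1 ?mnm1E.
Qed.

(** All other monomials of h have the same degree p+1 and contain x, hence are smaller. *)
Lemma hinv_lead : has_lead (hinv p M) (U_(1%R) *+ p.+1)%MM (gamma23 p M).
Proof.
have lt (m : 'X_{1..3}) : mdeg m = p.+1 -> (0 < m 0%R)%N ->
    supp_lt ('X_[m] : {mpoly F[3]}) (U_(1%R) *+ p.+1)%MM.
  move=> dm m0; apply/supp_ltX/grevlex_lt_x; first by rewrite dm mdegMn mdeg1 mul1n.
  by rewrite mulmnE mnm1E.
apply: has_leadDl.
  have := has_leadZ (a := gamma23 p M)
    (has_lead_exp (k := p.+1) (@has_leadX 3 F U_(1%R)%MM)).
  by rewrite expr1n mulr1.
rewrite mulrDr -!scalerAr /delta mulrBr.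
have -> : vx F ^+ p.-1 * (vx F * vz F) = vx F ^+ p * vz F.
  by rewrite mulrA -exprSr prednK ?prime_gt0.
rewrite /vx /vy /vz !mpolyXn -!mpolyXD.
apply: supp_ltZ; apply: supp_ltD; last first.
  by apply/supp_ltZ/lt; rewrite ?mdegD ?mnmDE ?mdegMn ?mulmnE ?mdeg1 ?mnm1E /=; lia.
apply: supp_ltD; last (apply: supp_ltD; [apply: supp_ltZ; apply: supp_ltB|]).
all: try apply: supp_ltZ.
all: apply: lt; rewrite ?mdegD ?mnmDE ?mdegMn ?mulmnE ?mdeg1 ?mnm1E /=; lia.
Qed.

End Leads.

(** * Localization at x *)

Section Invariants.

Variables (p : nat) (p_prime : prime p) (p_gt2 : (2 < p)%N) (F : fieldType).
Hypothesis charF : p \in [pchar F].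
Variable M : 'M[F]_2.
Hypotheses (gamma12_neq0 : gamma12 p M != 0) (gamma13_eq0 : gamma13 p M = 0).

Local Notation elem_ab := (elem_ab p).
Local Notation x := (vx F).
Local Notation y := (vy F).
Local Notation z := (vz F).
Local Notation b := (VM_gens p M).
Local Notation Ny := (orbit_product p M y).
Local Notation Nz := (orbit_product p M z).
Local Notation h := (hinv p M).
Local Notation inv := (VM_invariants p M).
Local Notation actc := (actc (p := p) M).
Local Notation actd := (actd (p := p) M).

Let p_gt0 : (0 < p)%N. Proof. exact: prime_gt0. Qed.

Lemma gamma23_neq0 : gamma23 p M != 0.
Proof.
by rewrite (gamma23E gamma12_neq0) oppr_eq0 mulf_neq0 ?lambda_neq0.
Qed.

Lemma VM_gens_lead i : has_lead (tnth b i) (tnth (gen_expo p) i)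
  (tnth (gen_lead (gamma23 p M)) i).
Proof.
case: i => [[|[|[|[|//]]]]] lt_i; rewrite !(tnth_nth 0) (tnth_nth 0%MM) /=.
- exact: has_leadX.
- exact: orbit_y_lead.
- exact: hinv_lead.
- exact: orbit_z_lead.
Qed.

Lemma comp_gens :
  [/\ 'X_0 \mPo b = x, 'X_1 \mPo b = Ny, 'X_(2%:R) \mPo b = h & 'X_(3%:R) \mPo b = Nz].
Proof. by rewrite !comp_mpolyXU. Qed.

Lemma comp_gens_invariant P : P \mPo b \in inv.
Proof.
apply/mem_invariants => g; rewrite /unip; set t := [tuple _; _; _].
apply: (@mpoly_rmorph_ext 4 F _ (comp_mpoly t \o comp_mpoly b) (comp_mpoly b)) => [a|i] /=.
  by rewrite !comp_mpolyC.
rewrite comp_mpolyXU -(tnth_nth 0 b i) -/(unip _ _ _).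
apply: (mem_invariants _ _ _).1; case: i => [[|[|[|[|//]]]]] lt_i; rewrite (tnth_nth 0) /=.
- by apply/mem_invariants => g'; have [] := unip_vars (actc g') (actd g').
- exact: orbit_product_invariant.
- exact: hinv_invariant.
- exact: orbit_product_invariant.
Qed.

Lemma size_nested k (f : {mpoly F[3]}) : deg_lt 2%:R k f -> (size (nested f) <= k)%N.
Proof.
move=> ltf; apply/leq_sizeP => l le_kl; apply/polyP => j; apply/polyP => i.
pose m : 'X_{1..3} := [multinom nth 0%N [:: i; j; l] (t : nat) | t < 3].
have [m0 m1 m2] : [/\ m 0%R = i, m 1%R = j & m 2%:R%R = l] by rewrite !mnmE.
rewrite -{1}m2 -{1}m1 -{1}m0 coef_nested !coef0; apply: memN_msupp_eq0.
by apply/negP => /ltf; rewrite m2 ltnNge le_kl.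
Qed.

Lemma nestedZx a : nested (a *: x) = (a *: 'X)%:P%:P.
Proof. by have [nx _ _] := nested_vars F; rewrite nestedZ nx -!rmorphM /= mul_polyC. Qed.

Lemma nestedZy a : nested (a *: y) = (a%:P%:P * 'X)%:P.
Proof. by have [_ ny _] := nested_vars F; rewrite nestedZ ny -!rmorphM. Qed.

Lemma nested_orbit_y : exists N, [/\ nested Ny = N%:P, N \is monic & size N = p.+1].
Proof.
exists (\prod_(a <- undup [seq actc g | g : elem_ab]) ('X - (- (a *: 'X))%:P)).
split; last 2 first.
- exact: monic_prod_XsubC.
- by rewrite size_prod_XsubC (size_actc p_prime charF gamma12_neq0 gamma13_eq0).
rewrite orbit_yE !rmorph_prod; apply: eq_bigr => a _ /=.
have [_ ny _] := nested_vars F.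
by rewrite rmorphD /= nestedZx ny polyCN opprK -rmorphD.
Qed.

Lemma nested_orbit_z : nested Nz \is monic /\ size (nested Nz) = (p ^ 2).+1.
Proof.
pose u g : {poly {poly F}} := - ((actc g *+ 2)%:P%:P * 'X + ((actc g ^+ 2 + actd g) *: 'X)%:P).
have -> : nested Nz = \prod_(g <- enum {: elem_ab}) ('X - (u g)%:P).
  rewrite (orbit_zE p_prime p_gt2 charF gamma12_neq0) rmorph_prod.
  apply: eq_bigr => g _ /=; have [nx ny nz] := nested_vars F.
  rewrite !(rmorphD (@nested F)) /= nz nestedZx nestedZy /u.
  by rewrite polyCN opprK [in RHS]polyCD.
by rewrite monic_prod_XsubC size_prod_XsubC -cardE card_elem_ab.
Qed.

(** Apart from x z^p, only [delta] involves z, and only to the first power. *)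
Lemma nested_hinv : lead_coef (nested h) = (gamma12 p M / 2%:R *: 'X)%:P /\
  size (nested h) = p.+1.
Proof.
rewrite (hinvE p_gt2 charF gamma12_neq0); set k := _ / 2%:R.
set g14 := gamma14 p M / _; set g24 := gamma24 p M / _.
set q := (X in k *: X); have k0 : k != 0.
  by rewrite mulf_neq0 ?invr_eq0 ?(natr2_neq0 p_gt2 charF).
have lt_r : deg_lt 2%:R 2 (k *: (q - x * z ^+ p)).
  have lt1 (i : 'I_3) m : (i < 2)%N -> deg_lt 2%:R 1 ('X_i ^+ m : {mpoly F[3]}).
    move=> lt_i; rewrite mpolyXn => m'; rewrite msuppX inE => /eqP->.
    by rewrite mulmnE mnm1E; case: eqP lt_i => // ->.
  have lt_z : deg_lt 2%:R 2 z by move=> m; rewrite msuppX inE => /eqP->; rewrite mnm1E.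
  have ltM P Q l : deg_lt 2%:R 1 P -> deg_lt 2%:R l Q -> deg_lt 2%:R l (P * Q : {mpoly F[3]}).
    exact: deg_ltM.
  have ltx := lt1 0 1 isT; have lty := lt1 1 1 isT; rewrite !expr1 in ltx lty.
  have e : q - x * z ^+ p = - ((lambda p M *+ 2) *: y ^+ p.+1)
      + x ^+ p.-1 * (g14 *: (y ^+ 2 - x * z) + lambda p M ^+ 2 *: y ^+ 2)
      + g24 *: (y * x ^+ p).
    by rewrite /q -!mul_mpolyC; ring.
  have lt2 (P : {mpoly F[3]}) : deg_lt 2%:R 1 P -> deg_lt 2%:R 2 P by apply: deg_ltW.
   apply: deg_ltZ; rewrite e; apply: deg_ltD.
    apply: deg_ltD; first by apply: deg_ltN; apply: deg_ltZ; apply: (lt2); apply: (lt1).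
    apply: (ltM); first exact: lt1.
    apply: deg_ltD; last by apply: deg_ltZ; apply: (lt2); apply: (lt1).
    by apply: deg_ltZ; apply: deg_ltB; [apply: (lt2); apply: (lt1) | apply: (ltM)].
  by apply: deg_ltZ; apply: (lt2); apply: (ltM) => //; apply: (lt1).
have [nx ny nz] := nested_vars F.
have nh : nested (k *: q) = ((k *: 'X)%:P)%:P * 'X^p + nested (k *: (q - x * z ^+ p)).
  rewrite -nestedZx -nz -rmorphXn -rmorphM -rmorphD; congr nested.
  by rewrite -scalerAl -scalerDr addrC subrK.
have kX0 : (k *: 'X)%:P != 0 :> {poly {poly F}}.
  by rewrite polyC_eq0 -size_poly_eq0 size_scale // size_polyX.
have szt : size ((k *: 'X)%:P%:P * 'X^p : {poly {poly {poly F}}}) = p.+1.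
  by rewrite mul_polyC size_scale // size_polyXn.
have szr : (size (nested (k *: (q - x * z ^+ p))) < p.+1)%N.
  by apply: leq_ltn_trans (size_nested lt_r) _; rewrite ltnS ltnW.
rewrite nh lead_coefDl ?size_polyDl szt //; split=> //.
by rewrite lead_coefM lead_coefC lead_coefXn mulr1.
Qed.

Section Lift.

Variable N : {poly {poly F}}.
Hypotheses (nestedN : nested Ny = N%:P).

(** Horner induction on [Q], after the same induction for its coefficients in F[x]; ['X_0] and
    ['X_1] suffice, so the variable of h does not occur. *)
Lemma lift_comp_poly Q : exists P,
  deg_lt 2%:R 1 P /\ nested (P \mPo b) = (Q \Po N)%:P.
Proof.
have [cx cy _ _] := comp_gens; have [nx ny nz] := nested_vars F.
have lift0 (q : {poly F}) : exists P, deg_lt 2%:R 1 P /\ nested (P \mPo b) = q%:P%:P.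
  elim/poly_ind: q => [|q a [P [ltP nP]]].
    by exists 0; split; [exact: deg_lt0|rewrite comp_mpoly0 rmorph0].
  exists (P * 'X_0 + a%:MP); split.
    apply: deg_ltD; last first.
      by move=> m; rewrite msuppC; case: ifP => // _; rewrite inE => /eqP->; rewrite mnm0E.
    rewrite mulrC; apply: (@deg_ltM _ _ _ 0) => // m.
    by rewrite msuppX inE => /eqP->; rewrite mnm1E.
  rewrite comp_mpolyD comp_mpolyC (rmorphM (comp_mpoly b)) /= cx.
  rewrite (rmorphD (@nested F)) (rmorphM (@nested F)) /= nP nx nestedC.
  by rewrite -!polyCM -!polyCD.
elim/poly_ind: Q => [|Q q [P [ltP nP]]].
  by exists 0; split; [exact: deg_lt0|rewrite comp_mpoly0 comp_poly0 rmorph0].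
have [P0 [lt0 nP0]] := lift0 q; exists (P * 'X_1 + P0); split.
  apply: deg_ltD => //.
  by rewrite mulrC; apply: (@deg_ltM _ _ _ 0) => // m; rewrite msuppX inE => /eqP->; rewrite mnm1E.
rewrite comp_mpolyD (rmorphM (comp_mpoly b)) /= cy (rmorphD (@nested F)) /=.
rewrite (rmorphM (@nested F)) /= nP nestedN nP0 comp_poly_MXaddC.
by rewrite -polyCM -polyCD.
Qed.

Hypotheses (monN : N \is monic) (szN : size N = p.+1).

Lemma shift_N g : shift (actc g *: 'X) N = N.
Proof.
have := (mem_invariants _ _ _).1 (orbit_product_invariant charF M y) g.
move/(congr1 (@nested F)); rewrite nested_unip nestedN map_polyC /=.
by rewrite [LHS]comp_polyC => /polyC_inj.
Qed.

(** Translating z does not affect the top coefficient, which is thus invariant under a nonzero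
    translation of y, hence a polynomial in [N]. *)
Lemma invariant_top f k : f \in inv -> size (nested f) = k.+1 ->
  exists P, deg_lt 2%:R 1 P /\ nested (P \mPo b) = ((nested f)`_k)%:P.
Proof.
move=> inv_f szf; have [g g0] := actc_neq0 p_prime gamma12_neq0.
have u0 : actc g *: 'X != 0 :> {poly F}.
  by rewrite -size_poly_eq0 size_scale // size_polyX.
have charR : p \in [pchar {poly F}] by rewrite pchar_poly.
have [|Q eQ] := shift_inv_comp (a := (nested f)`_k) charR u0 monN szN (shift_N g).
  have := congr1 (@nested F) ((mem_invariants _ _ _).1 inv_f g).
  rewrite nested_unip => /(congr1 (fun q : {poly {poly {poly F}}} => q`_k)).
  rewrite coef_shift_top; last by apply: leq_trans (size_poly _ _) _; rewrite szf.
  by rewrite coef_map.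
by have [P [ltP nP]] := lift_comp_poly Q; exists P; rewrite eQ.
Qed.

(** A translation of z by a nonzero multiple of x that fixes y acts as a single [shift] with trivial
    action on the coefficients. *)
Lemma invariant_degree f : f \in inv -> (p %| (size (nested f)).-1)%N.
Proof.
move=> inv_f; have [d d0 fix_d] := exists_pure_shift p_prime charF gamma12_neq0 gamma13_eq0.
have u0 : (d *: 'X)%:P != 0 :> {poly {poly F}}.
  by rewrite polyC_eq0 -size_poly_eq0 size_scale // size_polyX.
have charR : p \in [pchar {poly {poly F}}] by rewrite !pchar_poly.
apply: (shift_inv_dvdn charR u0).
have := congr1 (@nested F) (fix_d f inv_f); rewrite nested_unip.
rewrite mul0rn !polyC0 mul0r add0r expr0n add0r scale0r map_poly_id // => q _.
by rewrite /shift polyC0 addr0 comp_polyXr.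
Qed.

Lemma invariantB f g : f \in inv -> g \in inv -> f - g \in inv.
Proof.
move=> /mem_invariants inv_f /mem_invariants inv_g; apply/mem_invariants => e.
by rewrite -[in RHS](inv_f e) -[in RHS](inv_g e) /unip comp_mpolyB.
Qed.

Lemma invariantM f g : f \in inv -> g \in inv -> f * g \in inv.
Proof.
move=> /mem_invariants inv_f /mem_invariants inv_g; apply/mem_invariants => e.
by rewrite -[in RHS](inv_f e) -[in RHS](inv_g e) /unip rmorphM.
Qed.

(* The power [x^k] is not optimal, since each step of the induction on the
   degree in [z] multiplies by the power of [x] in the top coefficient of [h^m]. *)
Lemma localization m f : f \in inv -> (size (nested f) <= p * m)%N ->
  exists k P, deg_lt 2%:R m P /\ x ^+ k * f = P \mPo b.
Proof.
elim: m f => [|m IHm] f inv_f.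
  rewrite muln0 leqn0 size_poly_eq0 => /eqP f0; exists 0%N, 0; split.
    exact: deg_lt0.
  by rewrite comp_mpoly0 (@nested_inj F f 0) ?mulr0 // f0 rmorph0.
have [le_m _|gt_m le_m] := leqP (size (nested f)) (p * m).
  have [k [P [ltP e]]] := IHm f inv_f le_m; exists k, P; split=> //.
  exact: deg_ltW ltP.
(* The degree in z is a multiple of [p], at least [p * m] and below [p * m.+1]. *)
have szf : size (nested f) = (p * m).+1.
  have /dvdnP[j ej] := invariant_degree inv_f.
  have szj : size (nested f) = (p * j).+1.
    by rewrite mulnC -ej prednK //; apply: leq_ltn_trans gt_m.
  move: gt_m le_m; rewrite szj ltnS leq_pmul2l // ltn_pmul2l // ltnS => le_mj le_jm.
  by congr (_ * _).+1; apply/eqP; rewrite eqn_leq le_jm.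
have [P [ltP nP]] := invariant_top inv_f szf.
pose kap := (gamma12 p M / 2%:R)^-1.
have [cx cy ch _] := comp_gens.
(* The top coefficient of [h ^+ m] is x^m divided by [kap ^+ m]. Multiplying [f] by [x ^+ m]
   therefore lets the terms of degree [p * m] in z cancel. *)
pose f' := x ^+ m * f - ((kap ^+ m)%:MP * P * 'X_(2%:R) ^+ m \mPo b).
have inv_f' : f' \in inv.
  apply: invariantB (comp_gens_invariant _); apply: invariantM => //.
  by rewrite -cx -rmorphXn; apply: comp_gens_invariant.
have [lh szh] := nested_hinv; have [nx _ _] := nested_vars F.
have ef' : f' = x ^+ m * f - (kap ^+ m)%:MP * (P \mPo b) * h ^+ m.
  by rewrite /f' !(rmorphM (comp_mpoly b)) (rmorphXn (comp_mpoly b)) /= comp_mpolyC ch.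
have kap0 : gamma12 p M / 2%:R != 0.
  by rewrite mulf_neq0 ?invr_eq0 ?(natr2_neq0 p_gt2 charF).
have top_h : (nested h ^+ m)`_(p * m) = ((gamma12 p M / 2%:R *: 'X)%:P) ^+ m.
  by rewrite -lh -lead_coef_exp lead_coefE size_exp szh.
have szhm : (size (nested h ^+ m) <= (p * m).+1)%N.
  by apply: leq_trans (size_poly_exp_leq _ _) _; rewrite szh.
pose a := (nested f)`_(p * m); pose c := (kap ^+ m)%:P%:P : {poly {poly F}}.
have nf' : nested f' = ('X%:P ^+ m)%:P * nested f - (c * a)%:P * nested h ^+ m.
  rewrite ef' nestedB !nestedM !nestedXn nestedC nP nx.
  by rewrite (polyC_exp m 'X%:P) (polyCM c a).
have [|k [Q [ltQ eQ]]] := IHm f' inv_f'.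
  apply: size_le_drop.
    rewrite nf'; apply: leq_trans (size_polyD _ _) _.
    rewrite size_polyN geq_max !mul_polyC.
    by rewrite !(leq_trans (size_scale_leq _ _)) ?szf.
  rewrite nf' coefB !coefCM -/a top_h -polyC_exp -(polyC_exp m (_ *: 'X)) exprZn.
  suff -> : c * a * ((gamma12 p M / 2%:R) ^+ m *: 'X^m)%:P = ('X ^+ m)%:P * a.
    exact: subrr.
  rewrite mulrAC /c -polyCM (mul_polyC (kap ^+ m)) scalerA -exprMn mulVf // expr1n scale1r.
  by [].
exists (k + m)%N, (Q + 'X_0 ^+ k * ((kap ^+ m)%:MP * P * 'X_(2%:R) ^+ m)); split.
  apply: deg_ltD; first exact: deg_ltW ltQ.
  have lt1X (j : nat) : deg_lt 2%:R 1 ('X_0 ^+ j : {mpoly F[4]}).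
    by rewrite mpolyXn => e; rewrite msuppX inE => /eqP->; rewrite mulmnE mnm1E.
  apply: (@deg_ltM _ _ _ 0) (lt1X k) _; rewrite mul_mpolyC.
  apply: (@deg_ltM _ _ _ 0 m.+1) (deg_ltZ ltP) _.
  by rewrite mpolyXn => e; rewrite msuppX inE => /eqP->; rewrite mulmnE mnm1E mul1n.
rewrite comp_mpolyD -eQ ef' (rmorphM (comp_mpoly b)) /= (rmorphXn (comp_mpoly b)) /= cx.
rewrite !(rmorphM (comp_mpoly b)) (rmorphXn (comp_mpoly b)) /= comp_mpolyC ch.
by rewrite mulrBr subrK mulrA exprD.
Qed.

End Lift.

End Invariants.

(** * The SAGBI basis and the relation *)

Section AlgSpan.

Variables (F : fieldType) (n : nat).

Lemma alg_spanX (S : {mpoly F[n]} -> Prop) f k : alg_span S f -> alg_span S (f ^+ k).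
Proof.
move=> Sf; elim: k => [|k IHk]; last by rewrite exprS; apply: alg_spanM.
by rewrite expr0 -mpolyC1; apply: alg_spanC.
Qed.

Lemma alg_span_prod (S : {mpoly F[n]} -> Prop) (I : Type) (r : seq I)
    (G : I -> {mpoly F[n]}) :
  (forall i, alg_span S (G i)) -> alg_span S (\prod_(i <- r) G i).
Proof.
move=> SG; elim: r => [|i r IHr]; last by rewrite big_cons; apply: alg_spanM.
by rewrite big_nil -mpolyC1; apply: alg_spanC.
Qed.

Variable A : {pred {mpoly F[n]}}.
Hypothesis algA : subalg_closed A.

Lemma lin_span_add (S : {mpoly F[n]} -> Prop) f g :
  lin_span S f -> lin_span S g -> lin_span S (f + g).
Proof.
move=> Sf Sg; elim: Sf => [|a u v Su _ IH]; first by rewrite add0r.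
by rewrite -addrA; apply: lin_spanD.
Qed.

Lemma lead_term_algebraM f g :
  lead_term_algebra A f -> lead_term_algebra A g -> lead_term_algebra A (f * g).
Proof.
case: algA => _ _ closedM Af Ag; elim: Af => [|a u v [fu [Afu fu0 ->]] _ IH].
  by rewrite mul0r; apply: lin_span0.
rewrite mulrDl; apply: lin_span_add IH => {v}.
elim: Ag => [|c w v [fw [Afw fw0 ->]] _ IH]; first by rewrite mulr0; apply: lin_span0.
rewrite mulrDr; apply: lin_span_add IH.
rewrite -scalerAl -scalerAr scalerA -mpolyXD -lead_monM // -[_ *: _]addr0.
apply: lin_spanD (lin_span0 _); exists (fu * fw); split=> //; first exact: closedM.
exact: mulf_neq0.
Qed.

(** Only the inclusion of the lead term algebra has to be supplied; the other one holds because that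
    algebra contains the constants and is closed under sums and products. *)
Lemma lead_mons_sagbi (B : {pred {mpoly F[n]}}) : {subset B <= A} ->
  (forall f, f \in A -> f != 0 -> alg_span (lead_mons B) 'X_[lead_mon f]) ->
  sagbi_basis A B.
Proof.
move=> subBA leadA; split=> // f; split; last first.
  elim=> [|a u v [g [Ag g0 ->]] _ IH]; first by rewrite -mpolyC0; apply: alg_spanC.
  by apply: alg_spanD IH; rewrite -mul_mpolyC; apply: alg_spanM; [exact: alg_spanC|exact: leadA].
have [A1 _ _] := algA.
elim=> {f} [u [g [Bg g0 ->]]|a|u v _ IHu _ IHv|u v _ IHu _ IHv].
- rewrite -['X_[_]]scale1r -[_ *: _]addr0; apply: lin_spanD (lin_span0 _).
  by exists g; split=> //; apply: subBA.
- rewrite -[_%:MP]addr0 -[_%:MP]mulr1 mul_mpolyC; apply: lin_spanD (lin_span0 _).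
  exists 1; split=> //; first exact: oner_neq0.
  by rewrite (has_lead_lead_mon (@has_lead1 _ _) (oner_neq0 _)) mpolyX0.
- exact: lin_span_add.
- exact: lead_term_algebraM.
Qed.

End AlgSpan.

(** * Normal forms of the invariants *)

Section NormalFormOfInvariants.

Variables (p : nat) (p_prime : prime p) (p_gt2 : (2 < p)%N) (F : fieldType).
Hypothesis charF : p \in [pchar F].
Variable M : 'M[F]_2.
Hypotheses (gamma12_neq0 : gamma12 p M != 0) (gamma13_eq0 : gamma13 p M = 0).

Local Notation x := (vx F).
Local Notation b := (VM_gens p M).
Local Notation Nz := (orbit_product p M (vz F)).
Local Notation h := (hinv p M).
Local Notation inv := (VM_invariants p M).

Let p_gt0 : (0 < p)%N. Proof. exact: prime_gt0. Qed.
Let b_lead := VM_gens_lead p_prime p_gt2 charF gamma12_neq0 gamma13_eq0.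
Let c_neq0 := gamma23_neq0 p_prime charF gamma12_neq0 gamma13_eq0.

Let b_x : tnth b 0 = x. Proof. by []. Qed.

Lemma localize m f : f \in inv -> (size (nested f) <= p * m)%N ->
  exists k P, deg_lt 2%:R m P /\ x ^+ k * f = P \mPo b.
Proof.
have [N [nN monN szN]] := nested_orbit_y p_prime charF gamma12_neq0 gamma13_eq0.
exact: (localization p_prime p_gt2 charF gamma12_neq0 gamma13_eq0 nN monN szN).
Qed.

Lemma hinv_expp_normal : exists r, deg_lt 2%:R p r /\ h ^+ p = r \mPo b.
Proof.
have [cx _ ch cz] := comp_gens p M.
pose k := gamma12 p M / 2%:R.
have k0 : k != 0 by rewrite mulf_neq0 ?invr_eq0 ?(natr2_neq0 p_gt2 charF).
(* Both terms have top coefficient [(k *: x) ^+ p] in degree p^2 of z. So [f] has lower degree, and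
   localization with [m = p] yields a normal form. *)
pose f := (k ^+ p) *: (x ^+ p * Nz) - h ^+ p.
have ef : f = ((k ^+ p) *: ('X_0 ^+ p * 'X_(3%:R)) - 'X_(2%:R) ^+ p) \mPo b.
  rewrite comp_mpolyB comp_mpolyZ (rmorphM (comp_mpoly b)) !(rmorphXn (comp_mpoly b)) /=.
  by rewrite cx cz ch.
have inv_f : f \in inv by rewrite ef; apply: comp_gens_invariant.
have [monz szz] := nested_orbit_z p_prime p_gt2 charF gamma12_neq0.
have [lh szh] := nested_hinv p_gt2 charF gamma12_neq0.
have [nx _ _] := nested_vars F.
have nf : nested f = ((k *: 'X)%:P ^+ p)%:P * nested Nz - nested h ^+ p.
  rewrite /f nestedB nestedZ !nestedM !nestedXn nx mulrA; congr (_ * _ - _).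
  rewrite -(polyC_exp p 'X%:P) -(polyC_exp p 'X) -(polyC_exp p (_ *: _)).
  by rewrite -!polyCM exprZn mul_polyC.
have sz_f : (size (nested f) <= p * p)%N.
  apply: size_le_drop; rewrite nf.
    apply: leq_trans (size_polyD _ _) _; rewrite size_polyN geq_max.
    rewrite mul_polyC (leq_trans (size_scale_leq _ _)) ?szz ?mulnn //=.
    by apply: leq_trans (size_poly_exp_leq _ _) _; rewrite szh mulnn.
  rewrite coefB coefCM mulnn.
  have -> : (nested Nz)`_(p ^ 2) = 1 by move/monicP: monz; rewrite lead_coefE szz.
  have -> : (nested h ^+ p)`_(p ^ 2) = (k *: 'X)%:P ^+ p.
    by rewrite -lh -lead_coef_exp lead_coefE size_exp szh mulnn.
  by rewrite mulr1 subrr.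
have [e [P [ltP eP]]] := localize inv_f sz_f.
(* This solves for [x ^+ e * h ^+ p]; the added monomial does not contain the variable of h. *)
pose r := k ^+ p *: ('X_0 ^+ (e + p) * 'X_(3%:R)) - P.
have er : r \mPo b = x ^+ e * h ^+ p.
  rewrite /r comp_mpolyB -eP comp_mpolyZ (rmorphM (comp_mpoly b)) /=.
  rewrite (rmorphXn (comp_mpoly b)) /= cx cz /f mulrBr -scalerAr mulrA -exprD.
  by rewrite opprB addrC subrK.
have ltr : deg_lt 2%:R p r.
  apply: deg_ltB => //; apply: deg_ltZ; rewrite mpolyXn -mpolyXD => m.
  by rewrite msuppX inE => /eqP->; rewrite mnmDE mulmnE !mnm1E.
exact: (normal_div_xn p_gt0 c_neq0 b_lead b_x ltr er).
Qed.

(** Divide by ['X_2 ^+ p - r0], a relation that is monic in the variable of h. *)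
Lemma comp_gens_normal P : exists r, deg_lt 2%:R p r /\ P \mPo b = r \mPo b.
Proof.
have [r0 [lt0 e0]] := hinv_expp_normal; have [_ _ ch _] := comp_gens p M.
have [|Q [r [-> ltr]]] := @deg_lt_division _ _ 2%:R p ('X_(2%:R) ^+ p - r0) P.
  by rewrite addrAC subrr add0r; apply: deg_ltN.
exists r; split=> //; rewrite comp_mpolyD (rmorphM (comp_mpoly b)) /= comp_mpolyB.
by rewrite (rmorphXn (comp_mpoly b)) /= ch e0 subrr mulr0 add0r.
Qed.

Lemma invariant_normal f : f \in inv -> exists r, deg_lt 2%:R p r /\ f = r \mPo b.
Proof.
(* Any bound on the degree in z will do, since powers of h beyond the allowed range are reduced
   afterwards. *)
move=> inv_f; have [|k [P [_ eP]]] := @localize (size (nested f)) f inv_f.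
  by rewrite leq_pmull.
have [r [ltr er]] := comp_gens_normal P.
apply: (normal_div_xn p_gt0 c_neq0 b_lead b_x ltr).
by rewrite -er -eP.
Qed.

(** The lead monomial of a nonzero normal form is [expo I] for some [I], a product of lead monomials
    of generators. *)
Lemma VM_gens_sagbi : sagbi_basis inv [in b].
Proof.
have [cx cy ch cz] := comp_gens p M.
apply: lead_mons_sagbi; first exact: VM_invariants_subalg.
  move=> f /tnthP[i ->].
  have := comp_gens_invariant p_prime p_gt2 charF gamma12_neq0 gamma13_eq0 'X_i.
  by rewrite comp_mpolyXU -tnth_nth.
move=> f inv_f f0; have [r [ltr er]] := invariant_normal inv_f.
have r0 : r != 0 by apply: contraNneq f0 => r0; rewrite er r0 comp_mpoly0.
have [I Ir lr] := normal_lead p_gt0 b_lead r0 ltr.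
rewrite er (has_lead_lead_mon lr); last first.
  by rewrite mulf_neq0 ?expo_coef_neq0 // -mcoeff_msupp.
rewrite /expo (big_morph _ (@mpolyXD _ F) (@mpolyX0 _ F)).
apply: alg_span_prod => i; rewrite -mpolyXn; apply/alg_spanX/alg_span_gen.
have g0 : tnth (gen_lead (gamma23 p M)) i != 0.
  by rewrite (tnth_nth 0); case: i => [[|[|[|[|//]]]]] lt_i //=; apply: oner_neq0.
exists (tnth b i); split; [exact: mem_tnth|exact: has_lead_neq0 (@b_lead i) g0|].
by rewrite (has_lead_lead_mon (@b_lead i)).
Qed.

Lemma VM_gens_relation : single_relation_by_subducting b
  (gamma23 p M ^+ p *: 'X_1 ^+ p.+1 - 'X_(2%:R) ^+ p).
Proof.
set T := _ - _; have [cx cy ch cz] := comp_gens p M; split.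
  have [r [ltr ->]] := comp_gens_normal T; exists r.
  exact: (normal_subducts0 p_gt0 c_neq0 b_lead ltr).
move=> S sub_S; pose m := (U_(1%R) *+ (p.+1 * p))%MM : 'X_{1..3}.
(* Both terms of [T] evaluate to polynomials with lead term [gamma23 ^+ p] times ['X_[m]], and these
   cancel. *)
have lt_T : supp_lt (T \mPo b) m.
  have lead1 := has_leadZ (a := gamma23 p M ^+ p) (has_lead_exp (k := p.+1) (@b_lead 1)).
  have lead2 := has_lead_exp (k := p) (@b_lead 2%:R).
  have -> : T \mPo b = gamma23 p M ^+ p *: tnth b 1 ^+ p.+1 - tnth b 2%:R ^+ p.
    rewrite /T comp_mpolyB comp_mpolyZ !(rmorphXn (comp_mpoly b)) /=.
    by rewrite !comp_mpolyXU !(tnth_nth 0).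
  move: lead1 lead2; rewrite !(tnth_nth 0) !(tnth_nth 0%MM) /= expr1n mulr1.
  have -> : (U_(1%R) *+ p *+ p.+1)%MM = m.
    by apply/mnmP => i; rewrite !mulmnE mnm1E -mulnA [(p * _)%N]mulnC.
  have -> : (U_(1%R) *+ p.+1 *+ p)%MM = m.
    by apply/mnmP => i; rewrite !mulmnE mnm1E -mulnA.
  rewrite /has_lead => lead1 lead2; have := supp_ltB lead1 lead2.
  by rewrite opprB addrA subrK.
have lt_S := subducts0_supp c_neq0 b_lead sub_S lt_T.
have ltS : deg_lt 2%:R p S.
  (* If [I 2] were at least [p], the exponent of y alone would reach p(p+1), the degree of [m]. The
     degree bound then leaves only [expo p I = m], against strictness. *)
  move=> I /lt_S lt_I; rewrite ltnNge; apply/negP => le_p.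
  have [E0 E1 E2] := expoE p I.
  have mdeg3 (n : 'X_{1..3}) : mdeg n = (n 0%R + n 1%R + n 2%:R%R)%N.
    rewrite mdegE !big_ord_recr big_ord0 /= add0n.
    by congr (n _ + n _ + n _)%N; apply: val_inj.
  have : (mdeg (expo p I) <= mdeg m)%N by apply: grevlex_le_mdeg; rewrite /grevlex_le lt_I orbT.
  rewrite mdeg3 E0 E1 E2 mdegMn mdeg1 mul1n => le_deg.
  have [t eI2] : exists t, I 2%:R%R = (p + t)%N by exists (I 2%:R%R - p)%N; rewrite subnKC.
  have eI0 : I 0%R = 0%N by nia.
  have epI1 : (p * I 1%R + (p * t + t))%N = 0%N by nia.
  have eI1 : (p * I 1%R)%N = 0%N by lia.
  have et : t = 0%N by lia.
  have eI3 : (p ^ 2 * I 3%:R%R)%N = 0%N by nia.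
  suff eIm : expo p I = m by rewrite eIm grevlex_lt_irr in lt_I.
  apply/mnmP => -[[|[|[|//]]] lt_i]; rewrite mulmnE mnm1E -val_eqE /=.
  - by rewrite [Ordinal _](_ : _ = 0%R) ?E0 ?eI0 //; apply: val_inj.
  - rewrite [Ordinal _](_ : _ = 1%R); last exact: val_inj.
    by rewrite E1 eI2 et mulnDr eI1; lia.
  - by rewrite [Ordinal _](_ : _ = 2%:R%R) ?E2 ?eI3 //; apply: val_inj.
(* The opposite of [T - S] generates the same ideal and is monic in the variable of h. *)
suff rel : relation_ideal_generated_by b (S - T).
  have opp Q : Q * (T - S) = - Q * (S - T) by rewrite mulNr -mulrN opprB.
  move=> P; split=> [/(rel P).1[Q ->]|[Q eQ]].
    by exists (- Q); rewrite opp opprK.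
  by apply/(rel P); exists (- Q); rewrite eQ opp.
apply: (normal_relation p_gt0 c_neq0 b_lead).
  rewrite /T opprB [_ - _ *: _]addrC addrA addrK; apply: deg_ltB => //.
  apply: deg_ltZ => I; rewrite mpolyXn msuppX inE => /eqP->.
  by rewrite mulmnE mnm1E.
by rewrite comp_mpolyB (subducts0_comp sub_S) subrr.
Qed.

End NormalFormOfInvariants.

(* 'X_1 and 'X_(2%:R) stand for N_G(y) and h in {mpoly F[4]}. *)
Theorem theorem7p4 (p : nat) (p_prime : prime p) (p_gt2 : (2 < p)%N)
    (F : fieldType) (charF : p \in [pchar F]) (M : 'M[F]_2)
    (gamma12_neq0 : gamma12 p M != 0) (gamma13_eq0 : gamma13 p M = 0) :
  sagbi_basis (VM_invariants p M) [in VM_gens p M] /\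
  single_relation_by_subducting (VM_gens p M)
    (gamma23 p M ^+ p *: 'X_1 ^+ p.+1 - 'X_(2%:R) ^+ p).
Proof.
split; first exact: VM_gens_sagbi.
exact: VM_gens_relation.
Qed.
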